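(* Let $a,b\in\mathbb{C}\setminus\{0\}$, $c>0$, and $c>|a|+|b|+1$. Suppose that $$\frac{\Gamma(c)\,\Gamma(c-|a|-|b|)}{\Gamma(|b|)\,\Gamma(c-|b|)}\Bigg[\frac{2|a|}{c-|a|-|b|-1}\sum_{n=0}^{\infty}\binom{-(|a|+1)}{n}\frac{\Gamma(|b|+4+2n)}{\Gamma(c-|a|+3+2n)}\;{}_2F_1(|a|+1,|b|+4+2n;c-|a|+3+2n;-1)$$ $$+\sum_{n=0}^{\infty}\binom{-|a|}{n}\frac{\Gamma(|b|+2n)}{\Gamma(c-|a|+2n)}\;{}_2F_1(|a|,|b|+2n;c-|a|+2n;-1)\Bigg]\le 2.$$ Then the function $z\;{}_5F_4\left(a,\tfrac{b}{4},\tfrac{b+1}{4},\tfrac{b+2}{4},\tfrac{b+3}{4};\tfrac{c}{4},\tfrac{c+1}{4},\tfrac{c+2}{4},\tfrac{c+3}{4};z\right)$ belongs to the class $\mathcal{S}_p$.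
   Context: $\mathbb{D}=\{z\in\mathbb{C}:|z|<1\}$. $\mathcal{A}$ is the family of functions $f(z)=z+\sum_{n\ge2}a_nz^n$ analytic in $\mathbb{D}$, and $\mathcal{S}\subset\mathcal{A}$ is the subclass of univalent functions. $\mathcal{S}_p$ is the class of $f\in\mathcal{S}$ with $\left|\frac{zf'(z)}{f(z)}-1\right|<\mathrm{Re}\,\frac{zf'(z)}{f(z)}$ for all $z\in\mathbb{D}$. Pochhammer symbol: $(x)_0=1$, $(x)_n=x(x+1)\cdots(x+n-1)$; generalized binomial coefficient $\binom{-x}{n}=(-1)^n(x)_n/n!$. ${}_5F_4(a_1,\dots,a_5;b_1,\dots,b_4;z)=\sum_{n\ge0}\frac{(a_1)_n\cdots(a_5)_n}{(b_1)_n\cdots(b_4)_n\,(1)_n}z^n$ for $|z|<1$; ${}_2F_1(p,q;r;z)=\sum_{k\ge0}\frac{(p)_k(q)_k}{(r)_k(1)_k}z^k$ for $|z|<1$, extended as usual by analytic continuation to $z=-1$. *)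

(* Defs.v *)
From HB Require Import structures.
From mathcomp Require Import all_boot all_order all_algebra.
From mathcomp Require Import all_classical all_reals all_analysis.
From mathcomp Require Import complex.
Set Implicit Arguments.
Unset Strict Implicit.
Unset Printing Implicit Defensive.
Import Order.TTheory GRing.Theory Num.Theory.
Import numFieldNormedType.Exports.
Local Open Scope classical_set_scope.
Local Open Scope ring_scope.
Local Open Scope complex_scope.

(* R[i] packed as a numClosedFieldType: this is what triggers the inference of
   the topology and of the normed space structure over itself, so that
   [derivable f z 1] at type [C R] is complex differentiability.  The order of
   [C R] is the partial one: [x <= y] iff [y - x] is real and nonnegative. *)
Definition C (R : realType) : numClosedFieldType := R[i].

Definition toC (R : realType) (x : R) : C R := x%:C.

Definition disc (R : realType) : set (C R) := [set z | `|z| < 1].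
Arguments disc : clear implicits.

Definition holomorphic_on (R : realType) (U : set (C R)) (f : C R -> C R) :=
  forall z, U z -> derivable f z 1.

Definition class_A (R : realType) (f : C R -> C R) : Prop :=
  holomorphic_on (disc R) f /\
  exists u : nat -> C R, forall z, disc R z ->
    z + \sum_(2 <= n < N) u n * z ^+ n @[N --> \oo] --> f z.

Definition class_S (R : realType) (f : C R -> C R) : Prop :=
  class_A f /\ {in disc R &, injective f}.

(* z f'(z) / f(z); for f in class S the singularity at 0 is removable, with
   value 1 (whereas 0 / 0 is 0 in the library). *)
Definition zdlog (R : realType) (f : C R -> C R) (z : C R) : C R :=
  if z == 0 then 1 else z * derive1 f z / f z.

Definition class_Sp (R : realType) (f : C R -> C R) : Prop :=
  class_S f /\
  forall z, disc R z -> `|zdlog f z - 1| < 'Re (zdlog f z).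

Definition poch (F : pzSemiRingType) (x : F) (n : nat) : F :=
  \prod_(i < n) (x + i%:R).

(* The generalized binomial coefficient with upper entry - x. *)
Definition binomN (F : fieldType) (x : F) (n : nat) : F :=
  (-1) ^+ n * poch x n / n`!%:R.

Definition hyp_term (R : realType) (s t : seq (C R)) (z : C R) (n : nat) : C R :=
  (\prod_(x <- s) poch x n) / (\prod_(y <- t) poch y n * poch 1 n) * z ^+ n.

(* Generalized hypergeometric series with upper parameters s and lower
   parameters t; meaningful for |z| < 1. *)
Definition hyp (R : realType) (s t : seq (C R)) (z : C R) : C R :=
  limn (series (hyp_term s t z)).

(* The plane cut along [1, +oo); 1 <= z entails that z is real. *)
Definition slit_plane (R : realType) : set (C R) := [set z | ~~ (1 <= z)].
Arguments slit_plane : clear implicits.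

(* w is the value at z of an analytic continuation of the Gauss series to a
   domain of the slit plane containing the disc and z.  As the slit plane is
   simply connected, all such continuations are restrictions of the principal
   branch, so there is at most one such w. *)
Definition hyp2F1_value (R : realType) (p q r z w : C R) : Prop :=
  exists (U : set (C R)) (g : C R -> C R),
    [/\ open U, connected U, disc R `<=` U, U `<=` slit_plane R & U z] /\
    [/\ holomorphic_on U g,
        forall u, disc R u ->
          series (hyp_term [:: p; q] [:: r] u) @ \oo --> g u
      & w = g z].

Definition hyp2F1 (R : realType) (p q r z : C R) : C R :=
  xget 0 [set w | hyp2F1_value p q r z w].

(* Euler's integral, i.e. the Gamma function for x > 0. *)
Definition Gamma (R : realType) (x : R) : R :=
  \int[lebesgue_measure]_(t in `]0%R, +oo[) (t `^ (x - 1) * expR (- t)).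

Definition cabs (R : realType) (z : C R) : R := Normc.normc z.

(* Main.v *)
Require Import Defs.
From HB Require Import structures.
From mathcomp Require Import all_boot all_order all_algebra.
From mathcomp Require Import all_classical all_reals all_analysis.
From mathcomp Require Import measurable_realfun.
From mathcomp Require Import complex.
From mathcomp Require Import ring lra.
Set Implicit Arguments.
Unset Strict Implicit.
Unset Printing Implicit Defensive.
Import Order.TTheory GRing.Theory Num.Theory.
Import numFieldNormedType.Exports.
Local Open Scope classical_set_scope.
Local Open Scope ring_scope.

(* Write f(z) = z + sum_(n >= 1) h_n z^(n+1).  Since the four b/4-type parameters
   recombine into (b)_(4n) / 4^(4n), one has |h_n| <= t_n with
   t_n = (|a|)_n (|b|)_(4n) / ((c)_(4n) n!), and sum_(n >= 1) (2n+1) t_n <= 1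
   forces both univalence and |z f'/f - 1| < 1/2 < Re (z f'/f) on the disc.
   The left-hand side of the hypothesis is exactly sum_(n >= 0) (2n+1) t_n:
   t_n is a moment of a beta distribution, so sum t_n is the beta integral of
   (1 - t^4)^(-|a|) = (1-t)^(-|a|) (1+t)^(-|a|) (1+t^2)^(-|a|); expanding the last
   factor into its alternating binomial series and recognizing Euler's integral
   for 2F1(.; -1) gives the second series, and sum n t_n gives the first one
   with |a|, |b| replaced by |a| + 1, |b| + 4. *)

(** * Lebesgue integrals on the positive half line *)

(** The first obstacle is the exchange of sum and integral. At t = 1 the binomial series of (1 +
    t^2)^(-|a|) is on its circle of convergence, and after integration it need not converge
    absolutely; the hypothesis only says that it converges. So signs replace domination: all other
    expansions have nonnegative terms, and the alternating one has partial sums that enclose its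
    sum. The second obstacle is that -1 lies on the boundary of the disc of the Gauss series, its
    value there being defined by analytic continuation. The continuation is built explicitly, by
    expanding Euler's integral around -1. The condition c > |a| + |b| + 1 makes the integral behind
    sum n t_n converge: its weight is (1-t)^(c-|a|-|b|-2) near t = 1. Gamma being given as an
    integral, its properties are drawn from a single beta identity that needs only Tonelli and
    dilations. *)

Section half_line_integrals.
Context (R : realType).
Local Notation mu := (@lebesgue_measure R).
Local Notation Rp := (`]0%R, +oo[%classic : set (measurableTypeR R)).
Implicit Types (x y k : R) (f : R -> \bar R).

Lemma measurable_half_line : measurable Rp.
Proof. exact: measurable_itv. Qed.

(** The pushforward of the Lebesgue measure under multiplication by k, rescaled by k, agrees with it
    on the intervals ]a, b], hence everywhere by uniqueness. *)
Lemma ge0_integral_half_line_scale k f : 0 < k -> measurable_fun Rp f ->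
  (forall x, 0 < x -> (0 <= f x)%E) ->
  (\int[mu]_(x in Rp) f x = k%:E * \int[mu]_(x in Rp) f (k * x)%R)%E.
Proof.
move=> k0 mf f0.
have f0' : forall x, Rp x -> (0 <= f x)%E.
  by move=> x; rewrite /= in_itv/= andbT; exact: f0.
pose D : measurableTypeR R -> measurableTypeR R := *%R k.
have mD : measurable_fun setT D by exact: mulrl_measurable.
have DRp : D @^-1` Rp = Rp.
  by apply/seteqP; split => t /=; rewrite !in_itv/= !andbT pmulr_rgt0.
have f0D : {in Rp, forall y, (0 <= f y)%E} by move=> y; rewrite inE; exact: f0'.
have := ge0_integral_pushforward mD mu measurable_half_line mf f0D.
rewrite DRp -[X in _ = X -> _]/(\int[mu]_(x in Rp) f (k * x)%R)%E => <-.
rewrite -[k]/((NngNum (ltW k0))%:num) -ge0_integral_mscale//.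
apply: eq_measure_integral => A mA _.
apply: lebesgue_measure_unique => // _ [[a b]] _ <- /=.
rewrite /mscale/= /pushforward/=.
have -> : D @^-1` `]a, b]%classic = `]k^-1 * a, k^-1 * b]%classic.
  apply/seteqP; split => t /=; rewrite !in_itv/= /D => /andP[h1 h2]; apply/andP; split.
  - by rewrite mulrC ltr_pdivrMr// mulrC.
  - by rewrite mulrC ler_pdivlMr// mulrC.
  - by move: h1; rewrite mulrC ltr_pdivrMr// mulrC.
  - by move: h2; rewrite mulrC ler_pdivlMr// mulrC.
rewrite !lebesgue_measure_itv/= !lte_fin ltr_pM2l ?invr_gt0//.
case: ifP => _; last by rewrite mule0.
by rewrite -!EFinB -EFinM -mulrBr mulrA mulfV ?mul1r// gt_eqF.
Qed.

(** Multiplying by the indicators of both half lines reduces this to Tonelli on the whole plane. *)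
Lemma half_line_tonelli (f : R * R -> R) :
  measurable_fun [set: measurableTypeR R * measurableTypeR R] f ->
  (forall z, 0 <= f z) ->
  (\int[mu]_(x in Rp) \int[mu]_(y in Rp) (f (x, y))%:E =
   \int[mu]_(y in Rp) \int[mu]_(x in Rp) (f (x, y))%:E)%E.
Proof.
move=> mf f0.
pose g (z : measurableTypeR R * measurableTypeR R) : \bar R :=
  (f z * \1_Rp z.1 * \1_Rp z.2)%:E.
have mg : measurable_fun setT g.
  apply/measurable_EFinP; apply: measurable_funM; first apply: measurable_funM => //.
    by apply: (measurableT_comp (measurable_indic _)) => //.
  by apply: (measurableT_comp (measurable_indic _)) => //.
have g0 z : (0 <= g z)%E by rewrite lee_fin !mulr_ge0.
have E1 : (\int[mu]_(x in Rp) \int[mu]_(y in Rp) (f (x, y))%:E =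
    \int[mu]_x \int[mu]_y g (x, y))%E.
  rewrite integral_mkcond; apply: eq_integral => x _.
  rewrite patchE; case: ifPn => xD.
    rewrite integral_mkcond; apply: eq_integral => y _.
    rewrite patchE /g/= !indicE xD; case: ifPn => yD; by rewrite ?mulr1// mulr0.
  rewrite integral0_eq// => y _.
  by rewrite /g/= !indicE (negbTE xD) mulr0 mul0r.
have E2 : (\int[mu]_(y in Rp) \int[mu]_(x in Rp) (f (x, y))%:E =
    \int[mu]_y \int[mu]_x g (x, y))%E.
  rewrite integral_mkcond; apply: eq_integral => x _.
  rewrite patchE; case: ifPn => xD.
    rewrite integral_mkcond; apply: eq_integral => y _.
    rewrite patchE /g/= !indicE xD; case: ifPn => yD; by rewrite ?mulr1// mulr0.
  rewrite integral0_eq// => y _.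
  by rewrite /g/= !indicE (negbTE xD) mulr0.
rewrite E1 E2.
exact: (fubini_tonelli g mg g0).
Qed.

End half_line_integrals.

(** * The Gamma function *)

Section measurable_composition.
Context (R : realType).
Local Notation mu := (@lebesgue_measure R).
Local Notation Rp := (`]0%R, +oo[%classic : set (measurableTypeR R)).
Implicit Types (x y k z : R).

Lemma eq_half_line_integral (f g : R -> \bar R) :
  (forall t, 0 < t -> f t = g t) ->
  (\int[mu]_(t in Rp) f t = \int[mu]_(t in Rp) g t)%E.
Proof.
by move=> fg; apply: eq_integral => t; rewrite inE /= in_itv/= andbT => /fg.
Qed.

Lemma measurable_half_line_EFin (f : R -> R) :
  measurable_fun [set: measurableTypeR R] f -> measurable_fun Rp (EFin \o f).
Proof. by move=> mf; apply/measurable_EFinP/measurable_funTS. Qed.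

Lemma measurable_powR_comp d (T : measurableType d) (f : T -> R) x :
  measurable_fun setT f -> measurable_fun setT (fun t => f t `^ x).
Proof. by move=> mf; apply: (measurableT_comp (measurable_powR x)). Qed.

Lemma measurable_expR_comp d (T : measurableType d) (f : T -> R) :
  measurable_fun setT f -> measurable_fun setT (fun t => expR (f t)).
Proof. by move=> mf; apply: (measurableT_comp (@measurable_expR R)). Qed.

Lemma measurable_oppr_comp d (T : measurableType d) (f : T -> R) :
  measurable_fun setT f -> measurable_fun setT (fun t => - f t).
Proof. exact: measurable_funN. Qed.

End measurable_composition.

Ltac prove_measurable := repeat first
  [ exact: measurable_id | exact: measurable_cst
  | exact: mulrl_measurable | exact: measurable_fst | exact: measurable_snd
  | apply: measurable_half_line_EFin
  | apply: measurable_funM | apply: measurable_funD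
  | apply: measurable_funX | apply: measurable_powR_comp
  | apply: measurable_expR_comp | apply: measurable_oppr_comp].

Section gamma_function.
Context (R : realType).
Local Notation mu := (@lebesgue_measure R).
Local Notation Rp := (`]0%R, +oo[%classic : set (measurableTypeR R)).
Implicit Types (x y k z : R).

(** Kept in the extended reals so that Tonelli identities can be stated before finiteness is known;
    [eGammaE] then returns to [Gamma]. *)
Definition eGamma x : \bar R :=
  (\int[mu]_(t in Rp) (t `^ (x - 1) * expR (- t))%:E)%E.

Lemma eGamma_ge0 x : (0 <= eGamma x)%E.
Proof.
by apply: integral_ge0 => t _; rewrite lee_fin mulr_ge0 ?powR_ge0 ?expR_ge0.
Qed.

(** Valid for every real z, both sides being possibly infinite. Besides the beta identity, it
    supplies the exponential integrals that bound Gamma above and below, and the closed form of the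
    binomial series. *)
Lemma laplace_powR z k : 0 < k ->
  (\int[mu]_(t in Rp) (t `^ (z - 1) * expR (- (k * t)))%:E =
   (k `^ (- z))%:E * eGamma z)%E.
Proof.
move=> k0; rewrite /eGamma [in RHS](ge0_integral_half_line_scale k0); first last.
- by move=> t _; rewrite lee_fin mulr_ge0 ?powR_ge0 ?expR_ge0.
- by prove_measurable.
rewrite muleA -EFinM -ge0_integralZl_EFin//; first last.
- by rewrite mulr_ge0 ?powR_ge0// ltW.
- by prove_measurable.
- by move=> t _; rewrite lee_fin mulr_ge0 ?powR_ge0 ?expR_ge0.
apply: eq_half_line_integral => t t0; rewrite -EFinM; congr EFin.
rewrite powRM ?ltW// !mulrA; congr (_ * _); rewrite -[LHS]mul1r; congr (_ * _).
rewrite -{2}(powRr1 (ltW k0)) -!powRD ?(gt_eqF k0) ?implybT//.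
by rewrite (_ : _ + _ = 0) ?powRr0//; ring.
Qed.

Lemma integral_expRN : (\int[mu]_(t in Rp) (expR (- t))%:E = 1)%E.
Proof.
have cE : continuous (fun t : R => expR (- t)).
  by move=> t; apply: continuous_comp; [exact: continuousN|exact: continuous_expR].
rewrite integral_itv_obnd_cbnd; last first.
  by prove_measurable.
rewrite (@ge0_continuous_FTC2y R _ (fun x => - expR (- x)) _ 0)//.
- by rewrite oppr0 expR0 EFinN oppeK add0e.
- exact: continuous_subspaceT.
- by rewrite -oppr0; apply: cvgN; exact: cvgr_expR.
- by apply: cvgN; apply: cvg_at_right_filter; exact: cE.
- move=> t _; rewrite derive1N// derive1_comp// derive1N// derive1_id.
  rewrite derive1E; have /funeqP -> := @derive_expR R.
  by rewrite mulrN1 opprK.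
Qed.

Lemma eGamma1 : eGamma 1 = 1%E.
Proof.
rewrite -integral_expRN; apply: eq_half_line_integral => t t0.
by rewrite subrr powRr0 mul1r.
Qed.

(* Scaling v -> s v inside the inner integral and then s -> s / (1 + v) gives the
   beta integral with no change of variables but dilations. *)
Lemma eGamma_mul x y : (eGamma x * eGamma y = eGamma (x + y)%R *
  \int[mu]_(v in Rp) (v `^ (y - 1) * (1 + v) `^ (- (x + y)))%:E)%E.
Proof.
pose F (z : R * R) := `|z.1| `^ (x - 1) * expR (- z.1) *
  (z.1 * ((z.1 * z.2) `^ (y - 1) * expR (- (z.1 * z.2)))).
(* The absolute value only matters off the quadrant, where [half_line_tonelli] still asks for a
   nonnegative integrand. *)
pose G (z : measurableTypeR R * measurableTypeR R) := `|F z|.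
have mF : measurable_fun [set: measurableTypeR R * measurableTypeR R] F.
  rewrite /F; prove_measurable; apply: (measurableT_comp (@normr_measurable R setT)).
  exact: measurable_fst.
have mG : measurable_fun [set: measurableTypeR R * measurableTypeR R] G.
  exact: (measurableT_comp (@normr_measurable R setT)).
transitivity (\int[mu]_(s in Rp) \int[mu]_(v in Rp) (G (s, v))%:E)%E.
  rewrite muleC /eGamma -ge0_integralZl//; first last.
  - exact: eGamma_ge0.
  - by move=> t _; rewrite lee_fin mulr_ge0 ?powR_ge0 ?expR_ge0.
  - by prove_measurable.
  apply: eq_half_line_integral => s s0.
  rewrite muleC (ge0_integral_half_line_scale s0); first last.
  - by move=> t _; rewrite lee_fin mulr_ge0 ?powR_ge0 ?expR_ge0.
  - by prove_measurable.
  rewrite muleA -EFinM -ge0_integralZl_EFin//; first last.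
  - by rewrite !mulr_ge0 ?powR_ge0 ?expR_ge0// ltW.
  - by prove_measurable.
  - by move=> t _; rewrite lee_fin mulr_ge0 ?powR_ge0 ?expR_ge0.
  apply: eq_half_line_integral => v v0.
  rewrite -EFinM /G /F/= ger0_norm ?(gtr0_norm s0) ?mulrA//.
  by rewrite !mulr_ge0 ?powR_ge0 ?expR_ge0// ltW.
rewrite (half_line_tonelli mG); last by move=> z; exact: normr_ge0.
rewrite -ge0_integralZl//; first last.
- exact: eGamma_ge0.
- by move=> t _; rewrite lee_fin mulr_ge0 ?powR_ge0.
- by prove_measurable.
apply: eq_half_line_integral => v v0.
have v1 : 0 < 1 + v by rewrite addr_gt0.
rewrite EFinM muleCA (muleC (eGamma _)) -(laplace_powR (x + y) v1).
rewrite -ge0_integralZl_EFin ?powR_ge0//; first last.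
- by prove_measurable.
- by move=> t _; rewrite lee_fin mulr_ge0 ?powR_ge0 ?expR_ge0.
apply: eq_half_line_integral => s s0.
rewrite -EFinM /G /F/= ger0_norm ?(gtr0_norm s0); last first.
  by rewrite !mulr_ge0 ?powR_ge0 ?expR_ge0// ltW.
congr EFin; rewrite powRM ?ltW// mulrDl mul1r opprD expRD.
have -> : s `^ (x + y - 1) = s `^ (x - 1) * (s * s `^ (y - 1)).
  rewrite -[X in _ = _ * (X * _)](powRr1 (ltW s0)) -!powRD ?(gt_eqF s0) ?implybT//.
  by congr (_ `^ _); ring.
rewrite (mulrC v); ring.
Qed.

Lemma is_derive_powR1D p (v : R) : - 1 < v ->
  is_derive v 1 (fun v : R => (1 + v) `^ p) (p * (1 + v) `^ (p - 1)).
Proof.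
move=> v1; have v0 : 0 < 1 + v by rewrite -ltrBlDl sub0r.
have d1 : is_derive v 1 (fun v : R => 1 + v) 1.
  by have := is_deriveD (is_derive_cst (1 : R) v (1 : R)) (is_derive_id v (1 : R)); rewrite add0r.
have := @is_derive1_comp R (@powR R ^~ p) (fun v : R => 1 + v) v _ 1
  (is_derive1_powR p v0) d1.
by rewrite mulr1.
Qed.

Lemma cvgr_powR1DN x : 0 < x -> (1 + v) `^ (- x) @[v --> +oo] --> (0 : R).
Proof.
move=> x0; apply/cvgrPdist_lt => e e0; near=> v.
have v0 : 0 < 1 + v by rewrite addr_gt0//; near: v; exact: nbhs_pinfty_gt.
rewrite sub0r normrN ger0_norm ?powR_ge0// powRN.
rewrite -[e]invrK ltf_pV2 ?posrE ?invr_gt0 ?powR_gt0//.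
have -> : e^-1 = (e `^ (- x^-1)) `^ x.
  by rewrite -powRrM mulNr mulVf ?gt_eqF// powR_inv1// ltW.
rewrite gt0_ltr_powR ?nnegrE ?powR_ge0 ?(ltW v0)//.
rewrite ltr_wpDl//; near: v; exact: nbhs_pinfty_gt.
Unshelve. all: by end_near. Qed.

Lemma integral_powR1D x : 0 < x ->
  (\int[mu]_(v in Rp) ((1 + v) `^ (- (x + 1)))%:E = (x^-1)%:E)%E.
Proof.
move=> x0.
pose F (v : R) := - (x^-1 * (1 + v) `^ (- x)).
have dF (v : R) : 0 <= v -> is_derive v 1 F ((1 + v) `^ (- (x + 1))).
  move=> v0; have v1 : - 1 < v by rewrite (lt_le_trans _ v0)// oppr_lt0.
  have dP := @is_derive_powR1D (- x) v v1.
  apply: is_derive_eq.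
  rewrite /GRing.scale/= mulNr mulrN opprK mulrA mulVf ?mul1r ?gt_eqF//.
  by rewrite opprD.
have cP p (v : R) : 0 <= v -> {for v, continuous (fun v : R => (1 + v) `^ p)}.
  move=> v0; have v1 : - 1 < v by rewrite (lt_le_trans _ v0)// oppr_lt0.
  apply: differentiable_continuous; apply/derivable1_diffP.
  by have [] := @is_derive_powR1D p v v1.
rewrite integral_itv_obnd_cbnd; last by prove_measurable.
rewrite (@ge0_continuous_FTC2y R _ F _ 0)//.
- by rewrite /F addr0 powR1 mulr1 EFinN oppeK add0e.
- by move=> v _; rewrite powR_ge0.
- apply/continuous_within_itvcyP; split.
    by move=> v; rewrite in_itv/= andbT => v0; apply: cP; exact: ltW.
  by apply: cvg_at_right_filter; exact: cP.
- rewrite -oppr0; apply: cvgN; rewrite -(mulr0 x^-1).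
  by apply: cvgMr; exact: cvgr_powR1DN.
- by move=> v v0; have [] := dF v (ltW v0).
- apply: cvg_at_right_filter; apply: differentiable_continuous; apply/derivable1_diffP.
  by have [] := dF 0 (lexx _).
- move=> v; rewrite in_itv/= andbT => v0; rewrite derive1E.
  by have [_ ->] := dF v (ltW v0).
Qed.

(** Raise t / (2a) <= exp (t / (2a)) to the power a. This leaves half of the decay of exp (-t)
    available in the Gamma integral. *)
Lemma powR_le_expR (a t : R) : 0 < a -> 0 < t ->
  t `^ a <= (2 * a) `^ a * expR (t / 2).
Proof.
move=> a0 t0; have a20 : 0 < 2 * a by rewrite mulr_gt0.
have -> : expR (t / 2) = expR (t / (2 * a)) `^ a.
  rewrite /powR gt_eqF ?expR_gt0// expRK; congr expR; field; lra.
rewrite -powRM ?expR_ge0 ?(ltW a20)//.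
rewrite ge0_ler_powR ?nnegrE ?mulr_ge0 ?expR_ge0 ?(ltW a20) ?(ltW t0) ?(ltW a0)//.
rewrite mulrC -ler_pdivrMr// (le_trans _ (expR_ge1Dx _))//.
by rewrite lerDr.
Qed.

(** This is [eGamma_mul] at y = 1, where the beta integral is elementary: no integration by parts,
    and no finiteness needed. *)
Lemma eGammaS x : 0 < x -> (eGamma x = eGamma (x + 1) * (x^-1)%:E)%E.
Proof.
move=> x0; rewrite -[LHS]mule1 -eGamma1 eGamma_mul -(integral_powR1D x0).
congr (_ * _)%E; apply: eq_half_line_integral => t t0.
by rewrite subrr powRr0 mul1r.
Qed.

(** Passing first to x + 1 removes the singularity at 0: the integrand t^x exp (-t) is then at most
    (2x)^x exp (-t/2). *)
Lemma eGamma_fin_num x : 0 < x -> eGamma x \is a fin_num.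
Proof.
move=> x0; rewrite (eGammaS x0) fin_numM//.
rewrite ge0_fin_numE ?eGamma_ge0//.
have h : (0 : R) < 1 / 2 by lra.
apply: (@le_lt_trans _ _ (((2 * x) `^ x)%:E *
    \int[mu]_(t in Rp) (t `^ (1 - 1) * expR (- (1 / 2 * t)))%:E)%E).
  rewrite -ge0_integralZl_EFin ?powR_ge0//; first last.
  - by prove_measurable.
  - by move=> t _; rewrite lee_fin mulr_ge0 ?powR_ge0 ?expR_ge0.
  apply: ge0_le_integral => //.
  - by move=> t _; rewrite lee_fin mulr_ge0 ?powR_ge0 ?expR_ge0.
  - by prove_measurable.
  - by prove_measurable.
  move=> t; rewrite /= in_itv/= andbT => t0; rewrite -EFinM lee_fin.
  rewrite addrK subrr powRr0 mul1r.
  rewrite (_ : - (1 / 2 * t) = t / 2 - t); last by lra.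
  by rewrite expRD mulrA ler_wpM2r ?expR_ge0// powR_le_expR.
by rewrite laplace_powR// eGamma1 mule1 -EFinM ltry.
Qed.

Lemma eGammaE x : 0 < x -> eGamma x = (Gamma x)%:E.
Proof. by move=> x0; rewrite -(fineK (eGamma_fin_num x0)). Qed.

Lemma GammaS x : 0 < x -> Gamma (x + 1) = x * Gamma x.
Proof.
move=> x0; have := eGammaS x0.
rewrite !eGammaE ?addr_gt0// -EFinM => -[] ->.
by rewrite mulrCA mulfV ?mulr1// gt_eqF.
Qed.

(** For x <= 1, ln t <= t gives t^(x-1) >= exp ((x-1) t), so the integrand dominates exp (-(2-x) t),
    whose integral is positive. The functional equation carries this to larger x, by induction on an
    integer upper bound. *)
Lemma Gamma_gt0 x : 0 < x -> 0 < Gamma x.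
Proof.
move=> x0; have [n xn] : exists n : nat, x <= n.+1%:R.
  by exists (Num.truncn x); apply/ltW/truncnS_gt.
elim: n x x0 xn => [|n IH] x x0 xn.
  rewrite -lte_fin -(eGammaE x0).
  have k0 : 0 < 2 - x by lra.
  apply: (@lt_le_trans _ _
     (\int[mu]_(t in Rp) (t `^ (1 - 1) * expR (- ((2 - x) * t)))%:E)%E).
    by rewrite laplace_powR// eGamma1 mule1 lte_fin powR_gt0.
  apply: ge0_le_integral => //.
  - by move=> t _; rewrite lee_fin mulr_ge0 ?powR_ge0 ?expR_ge0.
  - by prove_measurable.
  - by prove_measurable.
  move=> t; rewrite /= in_itv/= andbT => t0; rewrite lee_fin.
  rewrite subrr powRr0 mul1r (_ : - ((2 - x) * t) = t * (x - 1) - t); last by ring.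
  rewrite expRD ler_wpM2r ?expR_ge0//.
  rewrite /powR gt_eqF// ler_expR mulrC.
  have tl : ln t <= t by rewrite -ler_expR lnK ?posrE// (le_trans _ (expR_ge1Dx _))// lerDr.
  nra.
have [x1|x1] := leP x 1; first by apply: IH => //; rewrite (le_trans x1)// ler1n.
rewrite -(subrK 1 x) GammaS ?subr_gt0// mulr_gt0 ?subr_gt0//.
by apply: IH; rewrite ?subr_gt0// lerBlDr natr1.
Qed.

End gamma_function.

(** * Pochhammer symbols and the binomial series *)

Section pochhammer.
Context (F : pzSemiRingType).
Implicit Type x : F.

Lemma poch0 x : poch x 0 = 1.
Proof. by rewrite /poch big_ord0. Qed.

Lemma pochSr x n : poch x n.+1 = poch x n * (x + n%:R).
Proof. by rewrite /poch big_ord_recr. Qed.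

Lemma pochS x n : poch x n.+1 = x * poch (x + 1) n.
Proof.
rewrite /poch big_ord_recl addr0; congr (_ * _).
by apply: eq_bigr => i _; rewrite /= /bump/= natrD addrA.
Qed.

Lemma pochD x m n : poch x (m + n) = poch x m * poch (x + m%:R) n.
Proof.
elim: n => [|n IH]; first by rewrite addn0 poch0 mulr1.
by rewrite addnS !pochSr IH natrD addrA mulrA.
Qed.

End pochhammer.

Lemma poch1 (F : comPzSemiRingType) n : poch (1 : F) n = n`!%:R.
Proof.
elim: n => [|n IH]; first by rewrite poch0 fact0.
by rewrite pochSr IH factS natrM mulrC -natr1 addrC.
Qed.

Lemma poch_gt0 (F : numDomainType) (x : F) n : 0 < x -> 0 < poch x n.
Proof. by move=> x0; rewrite prodr_gt0// => i _; rewrite ltr_wpDr. Qed.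

Section binomial_series.
Context (R : realType).
Local Notation mu := (@lebesgue_measure R).
Local Notation Rp := (`]0%R, +oo[%classic : set (measurableTypeR R)).
Implicit Types (x y P : R).

Lemma factr_gt0 n : 0 < n`!%:R :> R.
Proof. by rewrite ltr0n fact_gt0. Qed.

Lemma factr_neq0 n : n`!%:R != 0 :> R.
Proof. by rewrite gt_eqF// factr_gt0. Qed.

Lemma Gamma_poch x n : 0 < x -> Gamma (x + n%:R) = poch x n * Gamma x.
Proof.
move=> x0; elim: n => [|n IH]; first by rewrite addr0 poch0 mul1r.
by rewrite -natr1 addrA (GammaS (ltr_wpDr (ler0n _ _) x0)) IH pochSr mulrCA mulrA.
Qed.

(** Termwise differentiation of the binomial series, which trades the exponent -x for -(x + 1). *)
Lemma binomNS x n : binomN x n.+1 * n.+1%:R = - x * binomN (x + 1) n.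
Proof.
rewrite /binomN pochS factS natrM exprS.
have := factr_neq0 n; have : n.+1%:R != 0 :> R by rewrite pnatr_eq0.
by move=> ? ?; field; apply/andP.
Qed.

(** Induction on N for all P at once: the signed remainder [D] vanishes at 0, and its derivative is
    P times the signed remainder of order N for P + 1, so [D] is nondecreasing. No bound y < 1 is
    imposed, so divergence of the series does not matter. *)
Lemma binomN_envelope N P y : 0 < P -> 0 <= y ->
  0 <= (-1) ^+ N * ((1 + y) `^ (- P) - \sum_(n < N) binomN P n * y ^+ n).
Proof.
elim: N P y => [|N IH] P y P0 y0.
  by rewrite expr0 mul1r big_ord0 subr0 powR_ge0.
pose D (v : R) := (-1) ^+ N.+1 *
  ((1 + v) `^ (- P) - \sum_(n < N.+1) binomN P n * v ^+ n).
have D0 : D 0 = 0.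
  rewrite /D addr0 powR1 big_ord_recl big1 ?expr0 ?mulr1.
    by rewrite /binomN poch0 fact0 expr0 mulr1 divr1 addr0 subrr mulr0.
  by move=> i _; rewrite expr0n/= mulr0.
have dS n (v : R) : is_derive v 1 (fun v => \sum_(i < n.+1) binomN P i * v ^+ i)
    (- P * \sum_(i < n) binomN (P + 1) i * v ^+ i).
  elim: n => [|n IHn].
    under eq_fun do rewrite big_ord1 expr0 mulr1.
    by rewrite big_ord0 mulr0; exact: is_derive_cst.
  under eq_fun do rewrite big_ord_recr/=.
  rewrite big_ord_recr mulrDr/=.
  apply: is_deriveD.
  have h : is_derive v (1 : R) (fun v : R => v ^+ n.+1) (n.+1%:R * v ^+ n).
    by split; [exact: exprn_derivable|rewrite exp_derive /GRing.scale/= mulr1].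
  apply: (@is_derive_eq _ _ _ _ _ _ _ _ (is_deriveZ (binomN P n.+1) h)).
  by rewrite /GRing.scale/= mulrA binomNS -mulrA.
have dD (v : R) : 0 <= v -> is_derive v 1 D (P * ((-1) ^+ N *
    ((1 + v) `^ (- (P + 1)) - \sum_(n < N) binomN (P + 1) n * v ^+ n))).
  move=> v0; have v1 : - 1 < v by rewrite (lt_le_trans _ v0)// oppr_lt0.
  have h1 := is_derive_powR1D (- P) v1; have h2 := dS N v.
  apply: is_derive_eq.
  rewrite /GRing.scale/= exprS opprD; ring.
rewrite -/(D y) -D0.
apply: (@ger0_derive1_ndecry R D 0) => //.
- by move=> v; rewrite in_itv/= andbT => /ltW v0; have [] := dD v v0.
- move=> v; rewrite in_itv/= andbT => /ltW v0; rewrite derive1E.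
  have [_ ->] := dD v v0; apply: mulr_ge0; first exact: ltW.
  by apply: IH => //; rewrite addr_gt0.
- have cD v : 0 <= v -> {for v, continuous D}.
    move=> v0; apply: differentiable_continuous; apply/derivable1_diffP.
    by have [] := dD v v0.
  apply/continuous_within_itvcyP; split.
    by move=> v; rewrite in_itv/= andbT => v0; apply: cD; exact: ltW.
  by apply: cvg_at_right_filter; exact: cD.
Qed.

Lemma nneseries_cvgP (u : nat -> R) l : (forall n, 0 <= u n) ->
  (\sum_(0 <= n <oo) (u n)%:E = l%:E)%E <-> series u @ \oo --> l.
Proof.
move=> u0.
have E : (fun n => (\sum_(0 <= k < n) (u k)%:E)%E) = EFin \o series u.
  by apply/funext => n /=; rewrite sumEFin /series/=.
have cv : cvgn (fun n => (\sum_(0 <= k < n) (u k)%:E)%E).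
  by apply: is_cvg_nneseries => n _ _; rewrite lee_fin.
split=> [ul|ul].
  have := cv; rewrite ul E => /fine_cvg; exact.
apply/cvg_lim => //; rewrite E; apply: cvg_EFin => //.
by apply: nearW.
Qed.

Lemma nneseries_expR x : 0 <= x ->
  (\sum_(0 <= n <oo) (x ^+ n / n`!%:R)%:E = (expR x)%:E)%E.
Proof.
move=> x0; apply/nneseries_cvgP => [n|].
  by rewrite divr_ge0 ?exprn_ge0.
exact: is_cvg_series_exp_coeff.
Qed.

(** After multiplication by Gamma(P), the right-hand side is the integral of t^(P-1) exp (-t) exp (t
    y). Expanding exp (t y) and integrating termwise, all terms being nonnegative, produces Gamma(P
    + n) = (P)_n Gamma(P). *)
Lemma binomial_nneseries P y : 0 < P -> 0 <= y -> y < 1 ->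
  (\sum_(0 <= n <oo) (poch P n / n`!%:R * y ^+ n)%:E = ((1 - y) `^ (- P))%:E)%E.
Proof.
move=> P0 y0 y1.
have G0 := Gamma_gt0 P0.
have : (((1 - y) `^ (- P))%:E * eGamma P =
        \sum_(0 <= n <oo) (poch P n / n`!%:R * y ^+ n * Gamma P)%:E)%E.
  rewrite -laplace_powR ?subr_gt0//.
  transitivity (\int[mu]_(t in Rp) \sum_(0 <= n <oo)
      (t `^ (P - 1) * expR (- t) * ((t * y) ^+ n / n`!%:R))%:E)%E.
    apply: eq_half_line_integral => t t0.
    under eq_eseriesr do rewrite EFinM.
    rewrite nneseriesZl; last first.
      by move=> n _; rewrite lee_fin divr_ge0 ?exprn_ge0 ?mulr_ge0 ?(ltW t0).
    rewrite nneseries_expR ?mulr_ge0 ?(ltW t0)// -EFinM -mulrA -expRD.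
    by congr (_ * expR _)%:E; ring.
  rewrite integral_nneseries//; first last.
  - move=> n t; rewrite /= in_itv/= andbT => t0; rewrite lee_fin.
    by rewrite !mulr_ge0 ?powR_ge0 ?expR_ge0 ?exprn_ge0 ?invr_ge0 ?mulr_ge0 ?(ltW t0).
  - by move=> n; by prove_measurable.
  apply: eq_eseriesr => n _.
  rewrite -mulrA (mulrC _ (Gamma P)) mulrCA.
  transitivity ((y ^+ n / n`!%:R)%:E * eGamma (P + n%:R))%E; last first.
    rewrite eGammaE ?ltr_wpDr// Gamma_poch// -EFinM; congr EFin; ring.
  rewrite -ge0_integralZl_EFin//; first last.
  - by rewrite divr_ge0 ?exprn_ge0.
  - by prove_measurable.
  - by move=> t _; rewrite lee_fin mulr_ge0 ?powR_ge0 ?expR_ge0.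
  apply: eq_half_line_integral => t t0; rewrite -EFinM; congr EFin.
  have -> : t `^ (P + n%:R - 1) = t `^ (P - 1) * t ^+ n.
    rewrite -powR_mulrn ?(ltW t0)// -powRD ?(gt_eqF t0) ?implybT//.
    by congr (_ `^ _); ring.
  by rewrite exprMn; ring.
rewrite eGammaE//.
under eq_eseriesr do rewrite EFinM muleC.
rewrite nneseriesZl; last first.
  by move=> n _; rewrite lee_fin mulr_ge0 ?divr_ge0 ?exprn_ge0// ltW// poch_gt0.
rewrite muleC => /(congr1 (fun z => ((Gamma P)^-1)%:E * z)%E).
have V : (((Gamma P)^-1)%:E * (Gamma P)%:E = 1)%E.
  by rewrite -EFinM mulVf ?gt_eqF.
by rewrite !muleA V !mul1e => ->.
Qed.

End binomial_series.

(** * Beta integrals *)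

Section beta_integral.
Context (R : realType).
Local Notation mu := (@lebesgue_measure R).
Local Notation Rp := (`]0%R, +oo[%classic : set (measurableTypeR R)).
Implicit Types (x y k p q s t v : R) (f g : R -> R).

(* The substitution t = 1 / (1 + v) turns this into the integral of
   t^(x-1) (1-t)^(y-1) f(t) over ]0, 1[; staying on the half line avoids any
   change of variables.  The inverse is written as a power because [powR] is
   what the library knows to be measurable. *)
Definition betaI x y f : \bar R :=
  (\int[mu]_(v in Rp)
     (v `^ (y - 1) * (1 + v) `^ (- (x + y)) * f ((1 + v) `^ (-1)))%:E)%E.

Definition beta x y : R := Gamma x * Gamma y / Gamma (x + y).

Lemma beta_gt0 x y : 0 < x -> 0 < y -> 0 < beta x y.
Proof. by move=> x0 y0; rewrite divr_gt0 ?mulr_gt0 ?Gamma_gt0 ?addr_gt0. Qed.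

Lemma beta_pochl x y n : 0 < x -> 0 < y ->
  beta (x + n%:R) y = beta x y * (poch x n / poch (x + y) n).
Proof.
move=> x0 y0; rewrite /beta (addrAC x) !Gamma_poch ?addr_gt0//.
have := Gamma_gt0 (addr_gt0 x0 y0); have := poch_gt0 n (addr_gt0 x0 y0).
move: (Gamma (x + y)) (Gamma x) (Gamma y) => G G1 G2 /gt_eqF/negbT ? /gt_eqF/negbT ?.
by field; apply/andP.
Qed.

Lemma powR1DN1_itv v : 0 < v -> 0 < (1 + v) `^ (-1) < 1.
Proof.
move=> v0; have v1 : 0 < 1 + v by rewrite addr_gt0.
by rewrite powR_inv1 ?ltW// invr_gt0 v1 invf_lt1// ltrDl.
Qed.

Lemma eq_betaI x y f g : (forall t, 0 < t < 1 -> f t = g t) ->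
  betaI x y f = betaI x y g.
Proof.
move=> fg; apply: eq_half_line_integral => v v0.
by rewrite fg// powR1DN1_itv.
Qed.

Lemma betaI_shiftl x y k f :
  betaI (x + k) y f = betaI x y (fun t => t `^ k * f t).
Proof.
apply: eq_half_line_integral => v v0; have v1 : 0 < 1 + v by rewrite addr_gt0.
rewrite !mulrA; congr (_ * _)%:E; rewrite -mulrA; congr (_ * _).
by rewrite -powRrM -powRD ?(gt_eqF v1) ?implybT//; congr (_ `^ _); ring.
Qed.

Lemma betaI_shiftr x y k f :
  betaI x (y + k) f = betaI x y (fun t => (1 - t) `^ k * f t).
Proof.
apply: eq_half_line_integral => v v0; have v1 : 0 < 1 + v by rewrite addr_gt0.
rewrite !mulrA; congr (_ * _)%:E.
have -> : 1 - (1 + v) `^ (-1) = v * (1 + v) `^ (-1).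
  by rewrite powR_inv1 ?(ltW v1)//; field; rewrite gt_eqF.
rewrite powRM ?powR_ge0 ?(ltW v0)// -powRrM.
transitivity (v `^ (y - 1) * v `^ k * ((1 + v) `^ (- (x + y)) * (1 + v) `^ (-1 * k))).
  rewrite -!powRD ?(gt_eqF v1) ?(gt_eqF v0) ?implybT//.
  by congr (_ `^ _ * _ `^ _); ring.
by ring.
Qed.

Lemma betaI1 x y : 0 < x -> 0 < y -> betaI x y (fun=> 1) = (beta x y)%:E.
Proof.
move=> x0 y0; have xy0 := addr_gt0 x0 y0; have G0 := Gamma_gt0 xy0.
have := @eGamma_mul R x y; rewrite !eGammaE// -EFinM.
rewrite (_ : (\int[mu]_(v in _) _)%E = betaI x y (fun=> 1)); last first.
  by apply: eq_half_line_integral => v v0; rewrite mulr1.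
move=> /(congr1 (fun z => ((Gamma (x + y))^-1)%:E * z)%E).
rewrite muleA -!EFinM mulVf ?gt_eqF// mul1e => <-.
by rewrite /beta mulrC.
Qed.


Lemma ge0_weight x y v f : (forall t, 0 < t < 1 -> 0 <= f t) -> 0 < v ->
  0 <= v `^ (y - 1) * (1 + v) `^ (- (x + y)) * f ((1 + v) `^ (-1)).
Proof. by move=> f0 v0; rewrite !mulr_ge0 ?powR_ge0// f0// powR1DN1_itv. Qed.

Lemma measurable_weight x y f : measurable_fun [set: measurableTypeR R] f ->
  measurable_fun [set: measurableTypeR R] (fun v =>
    v `^ (y - 1) * (1 + v) `^ (- (x + y)) * f ((1 + v) `^ (-1))).
Proof.
move=> mf; apply: measurable_funM; first by prove_measurable.
by apply: (measurableT_comp mf); prove_measurable.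
Qed.

Lemma betaI_ge0 x y f : (forall t, 0 < t < 1 -> 0 <= f t) -> (0 <= betaI x y f)%E.
Proof.
move=> f0; apply: integral_ge0 => v; rewrite /= in_itv/= andbT => v0.
by rewrite lee_fin ge0_weight.
Qed.

Lemma le_betaI x y f g :
  measurable_fun [set: measurableTypeR R] f ->
  measurable_fun [set: measurableTypeR R] g ->
  (forall t, 0 < t < 1 -> 0 <= f t) -> (forall t, 0 < t < 1 -> f t <= g t) ->
  (betaI x y f <= betaI x y g)%E.
Proof.
move=> mf mg f0 fg; apply: ge0_le_integral => //.
- by move=> v; rewrite /= in_itv/= andbT => v0; rewrite lee_fin ge0_weight.
- by apply: measurable_half_line_EFin; exact: measurable_weight.
- by apply: measurable_half_line_EFin; exact: measurable_weight.
move=> v; rewrite /= in_itv/= andbT => v0.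
by rewrite lee_fin ler_wpM2l ?mulr_ge0 ?powR_ge0// fg// powR1DN1_itv.
Qed.

Lemma betaIZl x y k f : measurable_fun [set: measurableTypeR R] f ->
  (forall t, 0 < t < 1 -> 0 <= f t) -> 0 <= k ->
  betaI x y (fun t => k * f t) = (k%:E * betaI x y f)%E.
Proof.
move=> mf f0 k0; rewrite /betaI -ge0_integralZl_EFin//; first last.
- by apply: measurable_half_line_EFin; exact: measurable_weight.
- by move=> v; rewrite /= in_itv/= andbT => v0; rewrite lee_fin ge0_weight.
by apply: eq_half_line_integral => v v0; rewrite -EFinM mulrCA.
Qed.

Lemma betaI_fin_num x y f (M : R) : 0 < x -> 0 < y ->
  measurable_fun [set: measurableTypeR R] f ->
  (forall t, 0 < t < 1 -> 0 <= f t <= M) -> betaI x y f \is a fin_num.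
Proof.
move=> x0 y0 mf fM.
have f0 t : 0 < t < 1 -> 0 <= f t by move=> /fM/andP[].
have M0 : 0 <= M.
  have /fM/andP[h1 h2] : 0 < (2^-1 : R) < 1 by apply/andP; split; lra.
  exact: le_trans h2.
rewrite ge0_fin_numE ?betaI_ge0//.
apply: (@le_lt_trans _ _ (betaI x y (fun=> M * 1))); last first.
  by rewrite (@betaIZl x y M (fun=> 1))// betaI1// -EFinM ltry.
by apply: le_betaI => // t /fM/andP[? ?]; rewrite mulr1.
Qed.

Lemma betaI_nneseries x y (f : nat -> R -> R) g :
  (forall n, measurable_fun [set: measurableTypeR R] (f n)) ->
  (forall n t, 0 < t < 1 -> 0 <= f n t) ->
  (forall t, 0 < t < 1 -> (\sum_(0 <= n <oo) (f n t)%:E = (g t)%:E)%E) ->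
  (\sum_(0 <= n <oo) betaI x y (f n) = betaI x y g)%E.
Proof.
move=> mf f0 fg; rewrite -integral_nneseries//; first last.
- by move=> n v; rewrite /= in_itv/= andbT => v0; rewrite lee_fin ge0_weight// => t; exact: f0.
- by move=> n; by apply: measurable_half_line_EFin; exact: measurable_weight.
apply: eq_half_line_integral => v v0.
rewrite EFinM -fg ?powR1DN1_itv// -nneseriesZl; last first.
  by move=> n _; rewrite lee_fin f0// powR1DN1_itv.
by apply: eq_eseriesr => n _; rewrite EFinM.
Qed.

Lemma betaI_sum x y (f : nat -> R -> R) N :
  (forall n, measurable_fun [set: measurableTypeR R] (f n)) ->
  (forall n t, 0 < t < 1 -> 0 <= f n t) ->
  (\sum_(n < N) betaI x y (f n) = betaI x y (fun t => (\sum_(n < N) f n t)%R))%E.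
Proof.
move=> mf f0.
rewrite /betaI -(@ge0_integral_sum _ _ _ mu Rp _ _ (fun (n : 'I_N) v =>
  (v `^ (y - 1) * (1 + v) `^ (- (x + y)) * f n ((1 + v) `^ (-1)))%:E))//; first last.
- by move=> n v; rewrite /= in_itv/= andbT => v0; rewrite lee_fin ge0_weight// => t; exact: f0.
- by move=> n; by apply: measurable_half_line_EFin; exact: measurable_weight.
apply: eq_half_line_integral => v v0.
by rewrite sumEFin mulr_sumr.
Qed.

End beta_integral.

(** * Euler's integral for the Gauss function *)

Section euler_integral.
Context (R : realType).
Local Notation mu := (@lebesgue_measure R).
Local Notation Rp := (`]0%R, +oo[%classic : set (measurableTypeR R)).
Implicit Types (x y p q s t v : R).

(** Euler's integral for 2F1(p, q; q + s; x). Unlike the series at 0, it makes sense at x = -1. *)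
Definition euler p q s x : R :=
  fine (betaI q s (fun t => (1 - x * t) `^ (- p))) / beta q s.

Definition gauss_coef p q s n : R :=
  poch p n * poch q n / (poch (q + s) n * n`!%:R).

(* Taylor coefficients at -1 of the Gauss function with parameters p, q, q + s. *)
Definition gauss_coefN1 p q s n : R :=
  poch p n / n`!%:R *
  (fine (betaI q s (fun t => t ^+ n * (1 + t) `^ (- (p + n%:R)))) / beta q s).

(** Monotone convergence under the beta weight, restated as ordinary convergence of a real series
    after division by [beta q s]. *)
Lemma betaI_series q s (f : nat -> R -> R) g (u : nat -> R) : 0 < q -> 0 < s ->
  (forall n, measurable_fun [set: measurableTypeR R] (f n)) ->
  (forall n t, 0 < t < 1 -> 0 <= f n t) ->
  (forall t, 0 < t < 1 -> (\sum_(0 <= n <oo) (f n t)%:E = (g t)%:E)%E) ->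
  betaI q s g \is a fin_num ->
  (forall n, betaI q s (f n) = (u n * beta q s)%:E) ->
  series u @ \oo --> fine (betaI q s g) / beta q s.
Proof.
move=> q0 s0 mf f0 fg gfin fu; have b0 := beta_gt0 q0 s0.
have u0 n : 0 <= u n.
  rewrite -(pmulr_lge0 _ b0) -lee_fin -fu; apply: betaI_ge0 => t; exact: f0.
apply/nneseries_cvgP => //.
have := betaI_nneseries q s mf f0 fg.
under eq_eseriesr do rewrite fu EFinM muleC.
rewrite nneseriesZl; last by move=> n _; rewrite lee_fin.
rewrite -{1}(fineK gfin) => /(congr1 (fun z => z * ((beta q s)^-1)%:E)%E).
rewrite muleAC -EFinM mulfV ?gt_eqF// mul1e => ->.
by rewrite EFinM.
Qed.

Lemma betaI_exprn q s n : 0 < q -> 0 < s ->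
  betaI q s (fun t => t ^+ n) = (poch q n / poch (q + s) n * beta q s)%:E.
Proof.
move=> q0 s0; rewrite mulrC -beta_pochl// -betaI1 ?ltr_wpDr//.
rewrite betaI_shiftl; apply: eq_betaI => t /andP[t0 _].
by rewrite powR_mulrn ?mulr1// ltW.
Qed.

Lemma powRN_le (a b P : R) : 0 < P -> 0 < a -> a <= b -> b `^ (- P) <= a `^ (- P).
Proof.
move=> P0 a0 ab; have b0 : 0 < b by exact: lt_le_trans ab.
rewrite !powRN lef_pV2 ?posrE ?powR_gt0//.
by rewrite ge0_ler_powR ?nnegrE ?(ltW a0) ?(ltW b0) ?(ltW P0).
Qed.

Lemma fin_num_euler p q s x : 0 < p -> 0 < q -> 0 < s -> x < 1 ->
  betaI q s (fun t => (1 - x * t) `^ (- p)) \is a fin_num.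
Proof.
move=> p0 q0 s0 x1.
(* For t in ]0, 1[ the number 1 - x t lies between 1 and 1 - x, whatever the sign of x. *)
apply: (@betaI_fin_num _ _ _ _ ((Num.min 1 (1 - x)) `^ (- p))) => //.
  by prove_measurable.
move=> t /andP[t0 t1]; rewrite powR_ge0/= powRN_le//.
  by rewrite lt_min ltr01 subr_gt0.
rewrite ge_min; case: (leP x 0) => x0; apply/orP; [left|right]; nra.
Qed.

Lemma gauss_series_cvg p q s x : 0 < p -> 0 < q -> 0 < s -> 0 <= x < 1 ->
  series (fun n => gauss_coef p q s n * x ^+ n) @ \oo --> euler p q s x.
Proof.
move=> p0 q0 s0 /andP[x0 x1].
apply: (@betaI_series q s (fun n t => poch p n / n`!%:R * x ^+ n * t ^+ n)) => //.
- by move=> n; prove_measurable.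
- move=> n t /andP[t0 _]; rewrite !mulr_ge0 ?exprn_ge0 ?invr_ge0 ?(ltW t0)//.
  exact/ltW/poch_gt0.
- move=> t /andP[t0 t1]; rewrite -binomial_nneseries ?mulr_ge0 ?(ltW t0)//; last first.
    by nra.
  by apply: eq_eseriesr => n _; rewrite exprMn mulrA.
- exact: fin_num_euler.
move=> n; have h := poch_gt0 n p0.
rewrite betaIZl ?betaI_exprn//.
- rewrite -EFinM /gauss_coef invfM; congr EFin; ring.
- by move=> t /andP[t0 _]; rewrite exprn_ge0// ltW.
- by rewrite !mulr_ge0 ?invr_ge0 ?exprn_ge0// ltW.
Qed.

Lemma fin_num_coefN1 p q s n : 0 < p -> 0 < q -> 0 < s ->
  betaI q s (fun t => t ^+ n * (1 + t) `^ (- (p + n%:R))) \is a fin_num.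
Proof.
move=> p0 q0 s0; apply: (@betaI_fin_num _ _ _ _ 1) => //; first by prove_measurable.
move=> t /andP[t0 t1]; rewrite mulr_ge0 ?exprn_ge0 ?powR_ge0 ?(ltW t0)//=.
rewrite mulr_ile1 ?exprn_ge0 ?powR_ge0 ?(ltW t0) ?exprn_ile1 ?(ltW t0) ?(ltW t1)//.
rewrite [leRHS](_ : 1 = 1 `^ (- (p + n%:R))); last by rewrite powR1.
rewrite powRN_le//; first by rewrite ltr_wpDr.
by rewrite lerDl ltW.
Qed.

Lemma gauss_coef_ge0 p q s n : 0 < p -> 0 < q -> 0 < s -> 0 <= gauss_coef p q s n.
Proof.
move=> p0 q0 s0; rewrite /gauss_coef divr_ge0 ?mulr_ge0//; apply/ltW/poch_gt0 => //.
exact: addr_gt0.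
Qed.

Lemma gauss_coefN1_ge0 p q s n : 0 < p -> 0 < q -> 0 < s ->
  0 <= gauss_coefN1 p q s n.
Proof.
move=> p0 q0 s0; have b0 := beta_gt0 q0 s0.
rewrite !mulr_ge0 ?invr_ge0 ?(ltW b0) ?(ltW (poch_gt0 n p0))//.
apply: fine_ge0; apply: betaI_ge0 => t /andP[t0 _].
by rewrite mulr_ge0 ?exprn_ge0 ?powR_ge0 ?(ltW t0).
Qed.

Lemma betaI_coefN1 p q s n : 0 < p -> 0 < q -> 0 < s ->
  (betaI q s (fun t => t ^+ n * (1 + t) `^ (- (p + n%:R)))%R * (poch p n / n`!%:R)%:E =
   (gauss_coefN1 p q s n * beta q s)%:E)%E.
Proof.
move=> p0 q0 s0; have b0 := beta_gt0 q0 s0.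
rewrite /gauss_coefN1 -(fineK (fin_num_coefN1 n p0 q0 s0)) -EFinM; congr EFin.
by rewrite mulrC -!mulrA mulVf ?mulr1 ?gt_eqF.
Qed.

(** Rests on 1 - x t = (1 + t) (1 - (1 + x) t / (1 + t)): the binomial series of the second factor
    is an expansion in powers of 1 + x, with nonnegative terms and argument below 1. *)
Lemma gauss_seriesN1_cvg p q s x : 0 < p -> 0 < q -> 0 < s -> 0 <= x < 1 ->
  series (fun n => gauss_coefN1 p q s n * (1 + x) ^+ n) @ \oo --> euler p q s x.
Proof.
move=> p0 q0 s0 /andP[x0 x1].
apply: (@betaI_series q s (fun n t => poch p n / n`!%:R * (1 + x) ^+ n *
  (t ^+ n * (1 + t) `^ (- (p + n%:R))))) => //.
- by move=> n; prove_measurable.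
- move=> n t /andP[t0 _]; have h := poch_gt0 n p0.
  rewrite !mulr_ge0 ?exprn_ge0 ?invr_ge0 ?powR_ge0 ?(ltW t0) ?(ltW h)//.
  by rewrite addr_ge0.
- move=> t /andP[t0 t1].
  have t10 : 0 < 1 + t by rewrite addr_gt0.
  have xt1 : 0 < 1 - x * t by nra.
  have -> : (1 - x * t) `^ (- p) =
      (1 + t) `^ (- p) * (1 - (1 + x) * (t / (1 + t))) `^ (- p).
    have E : 1 - (1 + x) * (t / (1 + t)) = (1 - x * t) / (1 + t).
      by field; rewrite gt_eqF.
    rewrite E -powRM ?(ltW t10) ?divr_ge0 ?(ltW xt1) ?(ltW t10)//.
    by rewrite [(1 + t) * _]mulrC divfK ?gt_eqF.
  rewrite EFinM -binomial_nneseries//; first last.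
  + by rewrite mulrA ltr_pdivrMr// mul1r; nra.
  + by rewrite !mulr_ge0 ?invr_ge0 ?(ltW t0) ?(ltW t10)// addr_ge0.
  rewrite -nneseriesZl; last first.
    move=> n _; rewrite lee_fin !mulr_ge0 ?exprn_ge0 ?invr_ge0 ?(ltW (poch_gt0 n p0))//.
    by rewrite !mulr_ge0 ?invr_ge0 ?(ltW t0) ?(ltW t10)// addr_ge0.
  apply: eq_eseriesr => n _; rewrite -EFinM; congr EFin.
  rewrite opprD powRD ?(gt_eqF t10) ?implybT// powR_invn ?(ltW t10)//.
  by rewrite !exprMn exprVn; ring.
- by apply: fin_num_euler.
move=> n; have h := poch_gt0 n p0.
rewrite betaIZl ?betaI_exprn//.
- rewrite EFinM muleAC muleC (muleC _ (betaI _ _ _)) betaI_coefN1// -EFinM.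
  by congr EFin; ring.
- by prove_measurable.
- by move=> t /andP[t0 _]; rewrite mulr_ge0 ?exprn_ge0 ?powR_ge0// ltW.
- by rewrite !mulr_ge0 ?invr_ge0 ?exprn_ge0 ?addr_ge0// ltW.
Qed.

(** Expanding the powers of 1 + x in the series at -1, the left-hand side is a truncated coefficient
    of x^j. The bound holds already under the integral: with P = p + j, a partial sum of the
    binomial series at t / (1 + t) is at most (1 - t / (1 + t))^(-P) = (1 + t)^P, which the factor
    (1 + t)^(-P) cancels. *)
Lemma sum_coefN1_bin p q s j N : 0 < p -> 0 < q -> 0 < s ->
  \sum_(k < N) gauss_coefN1 p q s k * 'C(k, j)%:R <= gauss_coef p q s j.
Proof.
move=> p0 q0 s0; have b0 := beta_gt0 q0 s0.
rewrite -(ler_pM2r b0) mulr_suml -lee_fin.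
pose f k t := poch p k / k`!%:R * 'C(k, j)%:R * (t ^+ k * (1 + t) `^ (- (p + k%:R))).
have mf k : measurable_fun [set: measurableTypeR R] (f k) by prove_measurable.
have f0 k t : 0 < t < 1 -> 0 <= f k t.
  move=> /andP[t0 _]; have h := poch_gt0 k p0.
  by rewrite !mulr_ge0 ?exprn_ge0 ?invr_ge0 ?powR_ge0 ?(ltW t0) ?(ltW h).
have -> : ((\sum_(k < N) gauss_coefN1 p q s k * 'C(k, j)%:R * beta q s)%:E =
    betaI q s (fun t => \sum_(k < N) f k t)%R)%E.
  rewrite -betaI_sum// -sumEFin; apply: eq_bigr => k _; apply/esym.
  rewrite betaIZl//.
  - rewrite EFinM muleAC muleC (muleC _ (betaI _ _ _)) betaI_coefN1// -EFinM.
    by congr EFin; ring.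
  - by prove_measurable.
  - by move=> t /andP[t0 _]; rewrite mulr_ge0 ?exprn_ge0 ?powR_ge0// ltW.
  - by rewrite !mulr_ge0 ?invr_ge0// ltW// poch_gt0.
have -> : ((gauss_coef p q s j * beta q s)%:E =
    betaI q s (fun t => poch p j / j`!%:R * t ^+ j)%R)%E.
  rewrite betaIZl ?betaI_exprn//.
  - rewrite -EFinM /gauss_coef invfM; congr EFin; ring.
  - by move=> t /andP[t0 _]; rewrite exprn_ge0// ltW.
  - by rewrite !mulr_ge0 ?invr_ge0// ltW// poch_gt0.
apply: le_betaI => //.
- by apply: measurable_sum.
- by prove_measurable.
- by move=> t t01; apply: sumr_ge0 => k _; exact: f0.
move=> t /andP[t0 t1].
have t10 : 0 < 1 + t by rewrite addr_gt0.
(* With j + N terms, the first j, which vanish, can be split off however j and N compare. *)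
apply: (@le_trans _ _ (\sum_(k < j + N) f k t)).
  rewrite addnC big_split_ord/= lerDl sumr_ge0// => k _.
  by apply: f0; rewrite t0.
rewrite big_split_ord/= big1 ?add0r; last first.
  by move=> k _; rewrite /f bin_small// mulr0 mul0r.
pose P := p + j%:R; have P0 : 0 < P by rewrite ltr_wpDr.
have -> : \sum_(i < N) f (j + i)%N t = poch p j / j`!%:R * t ^+ j *
    ((1 + t) `^ (- P) * \sum_(i < N) poch P i / i`!%:R * (t / (1 + t)) ^+ i).
  rewrite !mulr_sumr; apply: eq_bigr => i _.
  rewrite /f pochD -/P natrD addrA -/P.
  rewrite opprD powRD ?(gt_eqF t10) ?implybT// powR_invn ?(ltW t10)//.
  rewrite exprMn exprVn exprD.
  have := congr1 (fun k : nat => k%:R : R) (bin_fact (leq_addr i j)).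
  rewrite addKn !natrM => E.
  have F0 := @factr_neq0 R; have Fj := F0 j; have Fi := F0 i; have Fji := F0 (j + i)%N.
  have -> : 'C(j + i, j)%:R = (j + i)`!%:R / (j`!%:R * i`!%:R) :> R.
    by rewrite -E mulfK// mulf_neq0.
  have tn : (1 + t) ^+ i != 0 by rewrite expf_neq0// gt_eqF.
  by field; rewrite Fi tn Fj Fji.
have h := poch_gt0 j p0.
rewrite ler_piMr//; first by rewrite !mulr_ge0 ?invr_ge0 ?exprn_ge0 ?(ltW t0) ?(ltW h).
have u0 : 0 <= t / (1 + t) by rewrite divr_ge0 ?ltW.
have u1 : t / (1 + t) < 1 by rewrite ltr_pdivrMr// mul1r ltrDr.
rewrite [leRHS](_ : 1 = (1 + t) `^ (- P) * (1 - t / (1 + t)) `^ (- P)); last first.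
  rewrite -powRM ?subr_ge0 ?(ltW t10) ?(ltW u1)//.
  rewrite (_ : (1 + t) * _ = 1) ?powR1//; field; by rewrite gt_eqF.
rewrite ler_wpM2l ?powR_ge0// -lee_fin -(binomial_nneseries P0 u0 u1) -sumEFin.
rewrite -(big_mkord xpredT (fun i => (poch P i / i`!%:R * (t / (1 + t)) ^+ i)%:E)).
apply: nneseries_lim_ge => n _ _.
by rewrite lee_fin !mulr_ge0 ?exprn_ge0 ?invr_ge0 ?(ltW (poch_gt0 n P0)).
Qed.

End euler_integral.

(** * Integration of the alternating binomial series *)

Section enveloping_series.
Context (R : realType).
Local Notation mu := (@lebesgue_measure R).
Local Notation Rp := (`]0%R, +oo[%classic : set (measurableTypeR R)).
Implicit Types (A B P x y s t v : R).

(* The partial sums of the binomial series at a nonnegative point lie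
   alternately above and below its sum, and this survives integration: the
   integrated series can only converge to the integral, even where the series
   itself diverges. *)
Lemma enveloping_integral (w h : R -> R) P s : 0 < P ->
  measurable_fun [set: measurableTypeR R] w ->
  measurable_fun [set: measurableTypeR R] h ->
  (forall v, 0 < v -> 0 <= w v) -> (forall v, 0 < v -> 0 <= h v <= 1) ->
  mu.-integrable Rp (EFin \o w) ->
  series (fun n => binomN P n * \int[mu]_(v in Rp) (w v * h v ^+ n)) @ \oo --> s ->
  \int[mu]_(v in Rp) (w v * (1 + h v) `^ (- P)) = s.
Proof.
move=> P0 mw mh w0 h01 wi cs.
have bdd (g : R -> R) : measurable_fun [set: measurableTypeR R] g ->
    (forall v, 0 < v -> `|g v| <= 1) ->
    mu.-integrable Rp (EFin \o (fun v => w v * g v)).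
  move=> mg g1; apply: (le_integrable _ _ _ wi) => //.
    by apply: measurable_half_line_EFin; exact: measurable_funM.
  move=> v; rewrite /= in_itv/= andbT => v0; rewrite lee_fin normrM.
  by rewrite ler_piMr// g1.
set J := (X in X = s).
have iJ : mu.-integrable Rp (EFin \o (fun v => w v * (1 + h v) `^ (- P))).
  apply: bdd; first by prove_measurable.
  move=> v v0; have /andP[h0 h1] := h01 v v0.
  rewrite ger0_norm ?powR_ge0//.
  rewrite [leRHS](_ : 1 = 1 `^ (- P)); last by rewrite powR1.
  by rewrite powRN_le// lerDl.
have ih n : mu.-integrable Rp (EFin \o (fun v => w v * h v ^+ n)).
  apply: bdd; first by prove_measurable.
  move=> v v0; have /andP[h0 h1] := h01 v v0.
  by rewrite ger0_norm ?exprn_ge0 ?exprn_ile1.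
have iS N : mu.-integrable Rp
    (EFin \o (fun v => w v * \sum_(n < N) binomN P n * h v ^+ n)) /\
  \int[mu]_(v in Rp) (w v * \sum_(n < N) binomN P n * h v ^+ n) =
  series (fun n => binomN P n * \int[mu]_(v in Rp) (w v * h v ^+ n)) N.
  elim: N => [|N [IH1 IH2]].
    have -> : (fun v => w v * \sum_(n < 0) binomN P n * h v ^+ n) = cst 0.
      by apply/funext => v; rewrite big_ord0 mulr0.
    rewrite /series/= big_geq//; split; last by rewrite Rintegral_cst// mul0r.
    by apply: (eq_integrable _ (cst 0%E)) => //; exact: integrable0.
  have E : (fun v => w v * \sum_(n < N.+1) binomN P n * h v ^+ n) =
      (fun v => w v * \sum_(n < N) binomN P n * h v ^+ n) \+
      (fun v => binomN P N * (w v * h v ^+ N)).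
    by apply/funext => v /=; rewrite big_ord_recr/= mulrDr mulrCA.
  have iZ : mu.-integrable Rp (EFin \o (fun v => binomN P N * (w v * h v ^+ N))).
    by have := integrableZl (@measurable_half_line R) (binomN P N) (ih N).
  rewrite E; split; first by have := integrableD (@measurable_half_line R) IH1 iZ.
  rewrite RintegralD// IH2 RintegralZl// /series/= big_nat_recr//=.
pose S := series (fun n => binomN P n * \int[mu]_(v in Rp) (w v * h v ^+ n)).
have JS N : 0 <= (-1) ^+ N * (J - S N).
  rewrite /S -(iS N).2 /J -RintegralB// -?RintegralZl//; last 2 first.
    by have := integrableB (@measurable_half_line R) iJ (iS N).1.
    by have [] := iS N.
  apply: Rintegral_ge0 => v; rewrite /= in_itv/= andbT => v0.
  have /andP[h0 h1] := h01 v v0.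
  by rewrite -mulrBr mulrCA mulr_ge0 ?w0// binomN_envelope.
(* Consecutive errors have opposite signs; in the limit their product becomes the square of J - s,
   which is thus at most 0. *)
have straddle N : (J - S N) * (J - S N.+1) <= 0.
  have := mulr_ge0 (JS N) (JS N.+1).
  rewrite exprS; have E : ((-1) ^+ N * (-1) ^+ N : R) = 1.
    by rewrite -exprD addnn -signr_odd odd_double.
  rewrite [X in 0 <= X -> _](_ : _ = - ((-1) ^+ N * (-1) ^+ N) * ((J - S N) * (J - S N.+1))).
    by rewrite E mulN1r oppr_ge0.
  by ring.
have cS1 : (fun N => S N.+1) @ \oo --> s by rewrite (cvg_shiftS S); exact: cs.
have : (J - s) * (J - s) <= 0.
  have c : (fun N => (J - S N) * (J - S N.+1)) @ \oo --> (J - s) * (J - s).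
    by apply: cvgM; apply: cvgB => //; exact: cvg_cst.
  rewrite -(cvg_lim _ c)//; apply: limr_le; first by apply/cvg_ex; eexists; exact: c.
  exact: nearW.
rewrite -expr2 => Js; apply/eqP; rewrite -subr_eq0 -sqrf_eq0 eq_le Js.
by rewrite real_exprn_even_ge0 ?num_real.
Qed.

(** Both series compute the beta integral of [g] with parameters B and y. The first expands (1 +
    t^2)^(-A). The second uses g(t) = (1-t)^A (1-t^4)^(-A): the factor (1-t)^A is absorbed by
    raising y to y + A, and (1-t^4)^(-A) has a nonnegative expansion. *)
Lemma binomial_beta_series A B y s : 0 < A -> 0 < B -> 0 < y ->
  series (fun n => binomN A n * (Gamma (B + 2 * n%:R) / Gamma (y + (B + 2 * n%:R))) *
    euler A (B + 2 * n%:R) y (-1)) @ \oo --> s ->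
  series (fun n => poch A n / n`!%:R * beta (B + (4 * n)%:R) (y + A)) @ \oo --> Gamma y * s.
Proof.
move=> A0 B0 y0 cs; have G0 := Gamma_gt0 y0.
(* With t = 1 / (1 + v), [w] is the beta weight times (1 + t)^(-A), and [h] is t^2. *)
pose w v := v `^ (y - 1) * (1 + v) `^ (- (B + y)) * (1 + (1 + v) `^ (-1)) `^ (- A).
pose h v : R := ((1 + v) `^ (-1)) ^+ 2.
pose g t : R := (1 + t) `^ (- A) * (1 + t ^+ 2) `^ (- A).
have le1 a : 0 <= a -> (1 + a) `^ (- A) <= 1 :> R.
  move=> a0; rewrite [leRHS](_ : 1 = 1 `^ (- A)); last by rewrite powR1.
  by rewrite powRN_le// lerDl.
have fin1 x : 0 < x -> betaI x y (fun t => (1 + t) `^ (- A)) \is a fin_num.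
  move=> x0; apply: (@betaI_fin_num _ _ _ _ 1) => //; first by prove_measurable.
  by move=> t /andP[t0 _]; rewrite powR_ge0/= le1// ltW.
have Jg : \int[mu]_(v in Rp) (w v * (1 + h v) `^ (- A)) = fine (betaI B y g).
  congr fine; apply: eq_half_line_integral => v v0.
  by rewrite /w /g /h !mulrA.
have gE : fine (betaI B y g) = Gamma y * s.
  rewrite -Jg; apply: enveloping_integral => //.
  - by rewrite /w; prove_measurable.
  - by rewrite /h; prove_measurable.
  - by move=> v v0; rewrite !mulr_ge0 ?powR_ge0.
  - move=> v v0; have /andP[t0 t1] := powR1DN1_itv v0.
    by rewrite exprn_ge0 ?exprn_ile1 ?(ltW t0) ?(ltW t1).
  - apply/integrableP; split; first by rewrite /w; prove_measurable.
    rewrite (_ : (\int[mu]_(x in _) _)%E = betaI B y (fun t => (1 + t) `^ (- A))).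
      by rewrite -ge0_fin_numE ?fin1// betaI_ge0// => t _; rewrite powR_ge0.
    apply: eq_half_line_integral => v v0; rewrite /= ger0_norm//.
    by rewrite !mulr_ge0 ?powR_ge0.
  rewrite (_ : (fun n => _) = (fun n => Gamma y * (binomN A n *
    (Gamma (B + 2 * n%:R) / Gamma (y + (B + 2 * n%:R))) *
      euler A (B + 2 * n%:R) y (-1)))); last first.
    apply/funext => n; have Bn : 0 < B + 2 * n%:R by rewrite ltr_wpDr ?mulr_ge0.
    have -> : \int[mu]_(v in Rp) (w v * h v ^+ n) =
        fine (betaI (B + 2 * n%:R) y (fun t => (1 + t) `^ (- A))).
      rewrite betaI_shiftl; congr fine; apply: eq_half_line_integral => v v0.
      have /andP[t0 t1] := powR1DN1_itv v0.
      rewrite /w /h -exprM -(natrM _ 2) (powR_mulrn _ (ltW t0)); congr EFin; ring.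
    rewrite /euler; under [in RHS]eq_fun do rewrite mulN1r opprK.
    rewrite /beta (addrC y).
    have fieldE (F : fieldType) (x z o p q : F) : o != 0 -> p != 0 -> q != 0 ->
        x * z = o * (x * (p / q) * (z / (p * o / q))).
      by move=> g1 p1 q1; field; rewrite g1 p1 q1.
    apply: fieldE; first exact: lt0r_neq0 G0.
      exact: lt0r_neq0 (Gamma_gt0 Bn).
    exact: lt0r_neq0 (Gamma_gt0 (addr_gt0 Bn y0)).
  have -> : series (fun n => Gamma y * (binomN A n *
    (Gamma (B + 2 * n%:R) / Gamma (y + (B + 2 * n%:R))) *
      euler A (B + 2 * n%:R) y (-1))) = (fun n => Gamma y * series (fun n => binomN A n *
    (Gamma (B + 2 * n%:R) / Gamma (y + (B + 2 * n%:R))) *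
      euler A (B + 2 * n%:R) y (-1)) n).
    by apply/funext => N; rewrite /series/= mulr_sumr.
  by apply: cvgM => //; exact: cvg_cst.
have yA : 0 < y + A by rewrite addr_gt0.
have gfin : betaI B y g \is a fin_num.
  apply: (@betaI_fin_num _ _ _ _ 1) => //; first by rewrite /g; prove_measurable.
  move=> t /andP[t0 _]; rewrite mulr_ge0 ?powR_ge0//= mulr_ile1 ?powR_ge0 ?le1 ?(ltW t0)//.
  by rewrite exprn_ge0// ltW.
apply/nneseries_cvgP.
  move=> n; apply: mulr_ge0; first by rewrite divr_ge0// ltW// poch_gt0.
  by rewrite ltW// beta_gt0// ltr_wpDr.
rewrite -gE fineK//.
transitivity (betaI B (y + A) (fun t => (1 - t ^+ 4) `^ (- A))); last first.
  rewrite betaI_shiftr; apply: eq_betaI => t /andP[t0 t1].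
  have a1 : 0 < 1 - t by rewrite subr_gt0.
  have a2 : 0 < 1 + t by rewrite addr_gt0.
  have a3 : 0 < 1 + t ^+ 2 by rewrite ltr_wpDr ?sqr_ge0.
  have -> : 1 - t ^+ 4 = (1 - t) * ((1 + t) * (1 + t ^+ 2)) by ring.
  rewrite !powRM ?mulr_ge0 ?(ltW a1) ?(ltW a2) ?(ltW a3)//.
  rewrite mulrA -powRD ?(gt_eqF a1) ?implybT// subrr powRr0 mul1r//.
rewrite -(@betaI_nneseries _ _ _ (fun n t => poch A n / n`!%:R * t ^+ (4 * n)))//.
- apply: eq_eseriesr => n _; rewrite betaIZl//.
  + rewrite betaI_exprn// beta_pochl// -EFinM; congr EFin; ring.
  + by move=> t /andP[t0 _]; rewrite exprn_ge0// ltW.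
  + by rewrite divr_ge0// ltW// poch_gt0.
- by move=> n; prove_measurable.
- move=> n t /andP[t0 _]; rewrite mulr_ge0 ?exprn_ge0 ?divr_ge0 ?(ltW t0)//.
  by rewrite ltW// poch_gt0.
move=> t /andP[t0 t1]; rewrite -binomial_nneseries ?exprn_ge0 ?exprn_ilt1 ?(ltW t0)//.
by apply: eq_eseriesr => n _; rewrite exprM.
Qed.

End enveloping_series.

(** * Convergence in the complex numbers *)

Section complex_toolkit.
Context (R : realType).
Local Notation K := (Defs.C R).
Local Notation Re := (@complex.Re R).
Local Notation Im := (@complex.Im R).
Implicit Types (z w h : K) (x y e r : R).

Lemma toCD x y : toC (x + y) = toC x + toC y.
Proof. exact: (raddfD (real_complex R)). Qed.

Lemma toCN x : toC (- x) = - toC x.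
Proof. exact: (raddfN (real_complex R)). Qed.

Lemma toCB x y : toC (x - y) = toC x - toC y.
Proof. by rewrite toCD toCN. Qed.

Lemma toCM x y : toC (x * y) = toC x * toC y.
Proof. exact: (rmorphM (real_complex R)). Qed.

Lemma toC_nat n : toC (n%:R : R) = n%:R.
Proof. exact: (rmorph_nat (real_complex R)). Qed.

Lemma toC0 : toC (0 : R) = 0. Proof. exact: toC_nat 0%N. Qed.

Lemma toC1 : toC (1 : R) = 1. Proof. exact: toC_nat 1%N. Qed.

Lemma toCX x n : toC (x ^+ n) = toC x ^+ n.
Proof. exact: (rmorphXn (real_complex R)). Qed.

Lemma toCV x : toC x^-1 = (toC x)^-1.
Proof. exact: (fmorphV (real_complex R)). Qed.

Lemma toC_sum (I : Type) (s : seq I) (P : pred I) (F : I -> R) :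
  toC (\sum_(i <- s | P i) F i) = \sum_(i <- s | P i) toC (F i).
Proof. exact: (raddf_sum (real_complex R)). Qed.

Lemma le_toC x y : (toC x <= toC y) = (x <= y).
Proof. exact: lecR. Qed.

Lemma lt_toC x y : (toC x < toC y) = (x < y).
Proof. exact: ltcR. Qed.

Lemma toC_inj : injective (@toC R).
Proof. exact: complexI. Qed.

Lemma gt0_toC (z : K) : 0 < z -> exists2 x, 0 < x & z = toC x.
Proof.
case: z => a b; rewrite ltcE/= => /andP[/eqP -> a0].
by exists a.
Qed.

Lemma normCE z : `|z| = toC (cabs z).
Proof. by []. Qed.

Lemma cabs_ge0 z : 0 <= cabs z.
Proof. by rewrite -le_toC -normCE toC0 normr_ge0. Qed.

Lemma cabs0 : cabs (0 : K) = 0.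
Proof. by apply: toC_inj; rewrite -normCE normr0 toC0. Qed.

Lemma cabs_eq0 z : (cabs z == 0) = (z == 0).
Proof. by rewrite -(inj_eq toC_inj) -normCE toC0 normr_eq0. Qed.

Lemma cabsD z w : cabs (z + w) <= cabs z + cabs w.
Proof. by rewrite -le_toC toCD -!normCE ler_normD. Qed.

Lemma cabsN z : cabs (- z) = cabs z.
Proof. by apply: toC_inj; rewrite -!normCE normrN. Qed.

Lemma cabsM z w : cabs (z * w) = cabs z * cabs w.
Proof. by apply: toC_inj; rewrite toCM -!normCE normrM. Qed.

Lemma cabsX z n : cabs (z ^+ n) = cabs z ^+ n.
Proof. by apply: toC_inj; rewrite toCX -!normCE normrX. Qed.

Lemma cabsV z : cabs z^-1 = (cabs z)^-1.
Proof. by apply: toC_inj; rewrite toCV -!normCE normfV. Qed.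

Lemma cabs_toC x : cabs (toC x) = `|x|.
Proof.
wlog x0 : x / 0 <= x.
  move=> H; have [/H//|/ltW] := leP 0 x; rewrite -oppr_ge0 => /H.
  by rewrite toCN cabsN normrN.
rewrite [RHS]ger0_norm//; apply: toC_inj; rewrite -normCE ger0_norm//.
by rewrite -toC0 le_toC.
Qed.

Lemma cabs_nat n : cabs (n%:R : K) = n%:R.
Proof. by rewrite -toC_nat cabs_toC ger0_norm. Qed.

Lemma cabs_sum (I : Type) (s : seq I) (P : pred I) (F : I -> K) :
  cabs (\sum_(i <- s | P i) F i) <= \sum_(i <- s | P i) cabs (F i).
Proof.
elim/big_ind2 : _ => //; first by rewrite cabs0.
by move=> z x w y zx wy; rewrite (le_trans (cabsD _ _))// lerD.
Qed.

Lemma cvgCP (T : Type) (F : set_system T) {FF : Filter F} (f : T -> K) z :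
  f @ F --> z <-> forall e, 0 < e -> \forall t \near F, cabs (z - f t) < e.
Proof.
split=> [/cvgrPdist_lt fz e e0|fz].
  have e0' : 0 < toC e by rewrite -toC0 lt_toC.
  by near=> t; rewrite -lt_toC -normCE; near: t; exact: fz.
apply/cvgrPdist_lt => _ /gt0_toC[e e0 ->].
by near=> t; rewrite normCE lt_toC; near: t; exact: fz.
Unshelve. all: by end_near. Qed.

Lemma nbhsCP z (P : set K) :
  nbhs z P <-> exists2 e, 0 < e & forall w, cabs (z - w) < e -> P w.
Proof.
split=> [/nbhs_ballP[_ /= /gt0_toC[e e0 ->] zP]|[e e0 zP]].
  by exists e => // w zw; apply: zP; rewrite -ball_normE /= normCE lt_toC.
apply/nbhs_ballP; exists (toC e); first by rewrite /= -toC0 lt_toC.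
by move=> w; rewrite -ball_normE /= normCE lt_toC; exact: zP.
Qed.

Lemma cvg_toC (u : nat -> R) x : u @ \oo --> x -> toC (u n) @[n --> \oo] --> toC x.
Proof.
move=> /cvgrPdist_lt ux; apply/cvgCP => e e0; near=> n.
by rewrite -toCB cabs_toC; near: n; exact: ux.
Unshelve. all: by end_near. Qed.

Lemma cabs_ReIm x y : cabs (x +i* y)%C <= `|x| + `|y|.
Proof.
have -> : (x +i* y)%C = toC x + toC y * (0 +i* 1)%C.
  by apply/eqP; rewrite eq_complex /= !mulr0 !mul0r mulr1 subr0 !addr0 add0r !eqxx.
rewrite (le_trans (cabsD _ _))// cabsM !cabs_toC.
have -> : cabs (0 +i* 1)%C = 1 :> R.
  by rewrite /cabs /= expr0n/= add0r expr1n sqrtr1.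
by rewrite mulr1.
Qed.

Lemma ReIm_cabs z : `|Re z| <= cabs z /\ `|Im z| <= cabs z.
Proof.
case: z => x y; rewrite /cabs/=; split; rewrite -sqrtr_sqr ler_wsqrtr//.
  by rewrite lerDl sqr_ge0.
by rewrite lerDr sqr_ge0.
Qed.

Lemma cvg_complexP (u : nat -> K) x y :
  (fun n => Re (u n)) @ \oo --> x -> (fun n => Im (u n)) @ \oo --> y ->
  u @ \oo --> ((x +i* y)%C : K).
Proof.
move=> /cvgrPdist_lt ux /cvgrPdist_lt uy; apply/cvgCP => e e0.
have e20 : 0 < e / 2 by rewrite divr_gt0.
near=> n.
rewrite (_ : _ - _ = ((x - Re (u n)) +i* (y - Im (u n)))%C); last by case: (u n).
rewrite (le_lt_trans (cabs_ReIm _ _))// [e]splitr ltrD//; near: n.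
- exact: ux.
- exact: uy.
Unshelve. all: by end_near. Qed.

Lemma series_Re (u : nat -> K) n : Re (series u n) = series (fun k => Re (u k)) n.
Proof.
rewrite /series/=; elim: n => [|n IH]; first by rewrite !big_geq.
by rewrite !big_nat_recr//= -IH; case: (\sum_(0 <= i < n) _) (u n) => [a b] [].
Qed.

Lemma series_Im (u : nat -> K) n : Im (series u n) = series (fun k => Im (u k)) n.
Proof.
rewrite /series/=; elim: n => [|n IH]; first by rewrite !big_geq.
by rewrite !big_nat_recr//= -IH; case: (\sum_(0 <= i < n) _) (u n) => [a b] [].
Qed.

(** Comparison test, applied to real and imaginary parts separately. *)
Lemma normal_cvg (u : nat -> K) (b : nat -> R) : (forall n, cabs (u n) <= b n) ->
  cvgn (series b) -> cvgn (series u).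
Proof.
move=> ub cb.
have aux (v : nat -> R) : (forall n, `|v n| <= b n) -> cvgn (series v).
  move=> vb; apply: normed_cvg; apply: (series_le_cvg _ _ vb cb) => n //.
  exact: le_trans (vb n).
have cR := aux _ (fun n => le_trans (ReIm_cabs (u n)).1 (ub n)).
have cI := aux _ (fun n => le_trans (ReIm_cabs (u n)).2 (ub n)).
apply/cvg_ex; eexists; apply: cvg_complexP.
  by under eq_fun do rewrite series_Re; exact: cR.
by under eq_fun do rewrite series_Im; exact: cI.
Qed.

Lemma cabs_lim_le (u : nat -> K) z M : u @ \oo --> z ->
  (\forall n \near \oo, cabs (u n) <= M) -> cabs z <= M.
Proof.
move=> /cvgCP uz uM; apply/ler_addgt0Pr => e e0.
have [n [h1 h2]] : exists n, cabs (z - u n) < e /\ cabs (u n) <= M.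
  near \oo => n; exists n; split; near: n; [exact: uz|exact: uM].
rewrite -(subrK (u n) z) (le_trans (cabsD _ _))// addrC lerD// ltW//.
Unshelve. all: by end_near. Qed.

Lemma cabs_series_le (u : nat -> K) (b : nat -> R) z M :
  (forall n, cabs (u n) <= b n) -> series u @ \oo --> z -> series b @ \oo --> M ->
  cabs z <= M.
Proof.
move=> ub uz bM; apply: (cabs_lim_le uz); apply: nearW => n.
have b0 k : 0 <= b k by exact: le_trans (cabs_ge0 _) (ub k).
apply: (@le_trans _ _ (series b n)).
  by rewrite /series/= (le_trans (cabs_sum _ _ _))// ler_sum.
rewrite -(cvg_lim _ bM)//; apply: nondecreasing_cvgn_le.
  by apply: nondecreasing_series => k _ _.
by apply/cvg_ex; exists M.
Qed.

End complex_toolkit.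

(** * Complex power series *)

Section power_series.
Context (R : realType).
Local Notation K := (Defs.C R).
Implicit Types (z w h : K) (x y e r k d : R) (a : nat -> K).

(** Follows from the recursion R_(n+1) = (x + d) R_n + d^2 n x^(n-1) for the remainder. Its
    consequence d n x^(n-1) <= (x + d)^n dominates the differentiated power series. *)
Lemma expr_rem_ge0 x d n : 0 <= x -> 0 <= d ->
  0 <= (x + d) ^+ n - x ^+ n - d * (n%:R * x ^+ n.-1).
Proof.
move=> x0 d0; elim: n => [|n IH]; first by rewrite !expr0 mul0r mulr0 subrr subr0.
have -> : (x + d) ^+ n.+1 - x ^+ n.+1 - d * (n.+1%:R * x ^+ n) =
    (x + d) * ((x + d) ^+ n - x ^+ n - d * (n%:R * x ^+ n.-1)) +
    d ^+ 2 * (n%:R * x ^+ n.-1).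
  have E : n%:R * x ^+ n = n%:R * x ^+ n.-1 * x.
    by case: n {IH} => [|n]; rewrite ?mul0r// -mulrA -exprSr.
  rewrite -natr1 mulrDl E mul1r !exprS; ring.
apply: addr_ge0; first by apply: mulr_ge0 => //; exact: addr_ge0.
by rewrite !mulr_ge0 ?exprn_ge0.
Qed.

(* Comparing with the remainder of the positive number |z| + d rather than with
   second derivatives keeps the bound free of polynomial factors in n. *)
Lemma expr_rem_le z h d n : 0 < d -> cabs h <= d ->
  cabs ((z + h) ^+ n - z ^+ n - h * (n%:R * z ^+ n.-1)) <=
  (cabs h / d) ^+ 2 *
    ((cabs z + d) ^+ n - cabs z ^+ n - d * (n%:R * cabs z ^+ n.-1)).
Proof.
move=> d0 hd; elim: n => [|n IH].
  by rewrite !expr0 !subrr !mul0r !mulr0 !subrr cabs0 mulr0.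
have -> : (z + h) ^+ n.+1 - z ^+ n.+1 - h * (n.+1%:R * z ^+ n) =
    (z + h) * ((z + h) ^+ n - z ^+ n - h * (n%:R * z ^+ n.-1)) +
    h ^+ 2 * (n%:R * z ^+ n.-1).
  have E : n%:R * z ^+ n = n%:R * z ^+ n.-1 * z.
    by case: n {IH} => [|n]; rewrite ?mul0r// -mulrA -exprSr.
  rewrite -natr1 mulrDl E mul1r !exprS; ring.
set T := (X in _ <= _ * X) in IH *.
have T0 : 0 <= T by apply: expr_rem_ge0; rewrite ?cabs_ge0 ?ltW.
have -> : (cabs z + d) ^+ n.+1 - cabs z ^+ n.+1 - d * (n.+1%:R * cabs z ^+ n) =
    (cabs z + d) * T + d ^+ 2 * (n%:R * cabs z ^+ n.-1).
  have E : n%:R * cabs z ^+ n = n%:R * cabs z ^+ n.-1 * cabs z.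
    by rewrite -mulrA -exprSr; case: n {IH T T0} => [|n]; rewrite ?mul0r.
  rewrite /T -natr1 mulrDl E mul1r !exprS; ring.
rewrite (le_trans (cabsD _ _))// [leRHS]mulrDr lerD//.
  rewrite cabsM [leRHS]mulrCA ler_pM ?cabs_ge0//.
  by rewrite (le_trans (cabsD _ _))// lerD2l.
rewrite !cabsM !cabsX cabs_nat expr_div_n [leRHS]mulrA divfK//.
by rewrite expf_neq0// gt_eqF.
Qed.

Definition pseriesC a z : K := limn (series (fun n => a n * z ^+ n)).

Lemma is_derive_cvg (f : K -> K) z (df : K) :
  (forall e, 0 < e -> exists2 d, 0 < d & forall h, h != 0 -> cabs h < d ->
     cabs (df - h^-1 * (f (h + z) - f z)) < e) ->
  is_derive z 1 f df.
Proof.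
move=> H.
have c : h^-1 *: ((f \o shift z) (h *: (1 : K)) - f z) @[h --> 0^'] --> df.
  apply/cvgCP => e e0; have [d d0 fd] := H e e0.
  apply/nbhsCP; exists d => // h.
  rewrite sub0r cabsN => hd h0 /=.
  rewrite /GRing.scale/= mulr1; exact: fd.
by split; [apply/cvg_ex; exists df|exact: cvg_lim c].
Qed.

Section radius.
Context (a : nat -> K) (rho : R).
Hypothesis ha : forall r, 0 <= r -> r < rho ->
  cvgn (series (fun n => cabs (a n) * r ^+ n)).

Lemma pseriesC_cvg z : cabs z < rho ->
  series (fun n => a n * z ^+ n) @ \oo --> pseriesC a z.
Proof.
move=> zr; apply: (normal_cvg _ (ha (cabs_ge0 z) zr)) => n.
by rewrite cabsM cabsX.
Qed.

(** With [d] half the distance from |z| to rho and M the sum of |a_n| (|z| + d)^n, [expr_rem_le]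
    summed over n bounds the first-order remainder by (|h| / d)^2 M. *)
Lemma pseriesC_derive z : cabs z < rho ->
  exists2 dz, series (fun n => a n * (n%:R * z ^+ n.-1)) @ \oo --> dz &
    is_derive z 1 (pseriesC a) dz.
Proof.
move=> zr; pose d := (rho - cabs z) / 2.
have d0 : 0 < d by rewrite divr_gt0// subr_gt0.
have r0 : 0 <= cabs z + d by rewrite addr_ge0 ?cabs_ge0 ?ltW.
have rr : cabs z + d < rho by rewrite /d; lra.
have := ha r0 rr => /cvg_ex[M cM].
have rem n : d * (n%:R * cabs z ^+ n.-1) <= (cabs z + d) ^+ n.
  have := expr_rem_ge0 n (cabs_ge0 z) (ltW d0).
  by have := exprn_ge0 n (cabs_ge0 z); lra.
have cd : cvgn (series (fun n => a n * (n%:R * z ^+ n.-1))).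
  apply: (@normal_cvg _ _ (fun n => d^-1 * (cabs (a n) * (cabs z + d) ^+ n))).
    move=> n; rewrite !cabsM cabs_nat cabsX [leRHS]mulrCA ler_wpM2l ?cabs_ge0//.
    by rewrite [leRHS]mulrC ler_pdivlMr// mulrC.
  rewrite (_ : series _ = (fun N => d^-1 * series (fun n => cabs (a n) * (cabs z + d) ^+ n) N)).
    by apply/cvg_ex; exists (d^-1 * M); apply: cvgM => //; exact: cvg_cst.
  by apply/funext => N; rewrite /series/= mulr_sumr.
case/cvg_ex: cd => dz cdz; exists dz; first exact: cdz.
apply: is_derive_cvg => e e0.
have M0 : 0 <= M.
  rewrite -(cvg_lim _ cM)//; apply: limr_ge; first by apply/cvg_ex; exists M.
  by apply: nearW => n; apply: sumr_ge0 => i _; rewrite mulr_ge0 ?cabs_ge0 ?exprn_ge0.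
(* The difference quotient is off by at most |h| M / d^2; the added 1 keeps the denominator positive
   when M = 0. *)
pose d' := Num.min d (e / (M / d ^+ 2 + 1)).
have Md0 : 0 < M / d ^+ 2 + 1 by rewrite ltr_wpDl// divr_ge0// exprn_ge0// ltW.
exists d'; first by rewrite lt_min d0 divr_gt0.
move=> h h0; rewrite lt_min => /andP[hd he].
have zhr : cabs (z + h) < rho.
  by rewrite (le_lt_trans (cabsD _ _))//; lra.
have c : series (fun n => a n * ((z + h) ^+ n - z ^+ n - h * (n%:R * z ^+ n.-1))) @ \oo
    --> pseriesC a (z + h) - pseriesC a z - h * dz.
  rewrite (_ : series _ = (fun N => series (fun n => a n * (z + h) ^+ n) N -
      series (fun n => a n * z ^+ n) N - h * series (fun n => a n * (n%:R * z ^+ n.-1)) N)).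
    apply: cvgB; first by apply: cvgB; exact: pseriesC_cvg.
    exact: (cvgM (cvg_cst h) cdz).
  apply/funext => N; rewrite /series/= mulr_sumr -!sumrB; apply: eq_bigr => n _.
  by ring.
have hb : cabs (pseriesC a (z + h) - pseriesC a z - h * dz) <= (cabs h / d) ^+ 2 * M.
  apply: (cabs_series_le (b := fun n => (cabs h / d) ^+ 2 * (cabs (a n) * (cabs z + d) ^+ n)) _ c).
    move=> n; rewrite cabsM [leRHS]mulrCA ler_wpM2l ?cabs_ge0//.
    rewrite (le_trans (expr_rem_le _ _ d0 (ltW hd)))// ler_wpM2l//.
      by rewrite exprn_ge0// divr_ge0 ?cabs_ge0 ?ltW.
    have := exprn_ge0 n (cabs_ge0 z).
    have : 0 <= d * (n%:R * cabs z ^+ n.-1).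
      by apply: mulr_ge0; [exact: ltW|rewrite mulr_ge0 ?exprn_ge0 ?cabs_ge0].
    lra.
  rewrite (_ : series _ = (fun N => (cabs h / d) ^+ 2 *
      series (fun n => cabs (a n) * (cabs z + d) ^+ n) N)).
    by apply: cvgM => //; exact: cvg_cst.
  by apply/funext => N; rewrite /series/= mulr_sumr.
have ch0 : 0 < cabs h by rewrite lt_neqAle eq_sym cabs_eq0 h0 cabs_ge0.
have -> : dz - h^-1 * (pseriesC a (h + z) - pseriesC a z) =
    - h^-1 * (pseriesC a (z + h) - pseriesC a z - h * dz).
  by rewrite (addrC h z) mulNr [in RHS]mulrBr mulKf// opprB.
rewrite cabsM cabsN cabsV mulrC ltr_pdivrMr//.
apply: (le_lt_trans hb).
have -> : (cabs h / d) ^+ 2 * M = cabs h * (M / d ^+ 2) * cabs h.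
  by field; rewrite gt_eqF.
rewrite ltr_pM2r//; move: he; rewrite ltr_pdivlMr// mulrDr mulr1; lra.
Qed.

End radius.

End power_series.

(** * The value at -1 of the Gauss function *)

Lemma derivable_shift (F : numFieldType) (f : F -> F) (c z : F) :
  derivable f (z + c) 1 -> derivable (fun w => f (w + c)) z 1.
Proof.
rewrite /derivable => H.
have E : (fun h => h^-1 *: (((fun w => f (w + c)) \o shift z) (h *: (1 : F)) - f (z + c)))
   = (fun h => h^-1 *: ((f \o shift (z + c)) (h *: (1 : F)) - f (z + c))).
  by apply/funext => h; rewrite /= addrA.
by rewrite E.
Qed.

Lemma series_expr0 (F : numFieldType) (b : nat -> F) :
  series (fun n => b n * 0 ^+ n) @ \oo --> b 0%N.
Proof.
rewrite -cvg_shiftS (_ : [sequence _]_n = cst (b 0%N)); first exact: cvg_cst.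
apply/funext => n; rewrite /series/= big_nat_recl// expr0 mulr1.
by rewrite big1 ?addr0// => i _; rewrite expr0n/= mulr0.
Qed.

Section gauss_function_at_N1.
Context (R : realType).
Local Notation K := (Defs.C R).
Implicit Types (z w u : K) (x e r p q s : R).

Lemma poch_toC x n : poch (toC x) n = toC (poch x n).
Proof.
elim: n => [|n IH]; first by rewrite !poch0 toC1.
by rewrite !pochSr IH toCM toCD toC_nat.
Qed.

Lemma discE z : disc R z = (cabs z < 1) :> Prop.
Proof. by rewrite /disc /= normCE -toC1 lt_toC. Qed.

Lemma hyp_term_gauss p q s z n :
  hyp_term [:: toC p; toC q] [:: toC (q + s)] z n = toC (gauss_coef p q s n) * z ^+ n.
Proof.
rewrite /hyp_term !big_cons !big_nil !mulr1 !poch_toC poch1.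
by rewrite -!toCM -toCV -toCM.
Qed.

(* At a boundary point of the disc continuity alone determines the value of a
   continuation, so no identity theorem is needed. *)
Lemma disc_cvg_eq (g1 g2 : K -> K) w :
  cabs w = 1 -> derivable g1 w 1 -> derivable g2 w 1 ->
  (forall u, disc R u -> g1 u = g2 u) -> g1 w = g2 w.
Proof.
move=> w1 d1 d2 g12.
have cg (g : K -> K) : derivable g w 1 -> forall e, 0 < e ->
    exists2 d, 0 < d & forall u, cabs (w - u) < d -> cabs (g w - g u) < e.
  move=> /derivable1_diffP/differentiable_continuous/cvgCP gw e e0.
  by apply/(@nbhsCP R w (fun u => cabs (g w - g u) < e)); exact: gw.
apply/eqP; rewrite -subr_eq0 -cabs_eq0 eq_le cabs_ge0 andbT.
apply/ler_addgt0Pr => e e0; rewrite add0r.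
have e20 : 0 < e / 2 by rewrite divr_gt0.
have [a1 a10 h1] := cg g1 d1 _ e20; have [a2 a20 h2] := cg g2 d2 _ e20.
pose m := Num.min (1 / 2) (Num.min a1 a2 / 2).
have m0 : 0 < m by rewrite lt_min !divr_gt0// lt_min a10.
have m1 : m <= 1 / 2 by rewrite ge_min lexx.
have ma1 : m < a1.
  have : m <= Num.min a1 a2 / 2 by rewrite ge_min lexx orbT.
  have : Num.min a1 a2 <= a1 by rewrite ge_min lexx.
  lra.
have ma2 : m < a2.
  have : m <= Num.min a1 a2 / 2 by rewrite ge_min lexx orbT.
  have : Num.min a1 a2 <= a2 by rewrite ge_min lexx orbT.
  lra.
pose u := toC (1 - m) * w.
have du : disc R u.
  by rewrite discE cabsM w1 mulr1 cabs_toC ger0_norm; lra.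
have wu : cabs (w - u) = m.
  have -> : w - u = toC m * w by rewrite /u toCB toC1; ring.
  by rewrite cabsM w1 mulr1 cabs_toC ger0_norm ?ltW.
have := h1 u; have := h2 u; rewrite wu => /(_ ma2) H2 /(_ ma1) H1.
have -> : g1 w - g2 w = (g1 w - g1 u) - (g2 w - g2 u).
  by rewrite (g12 _ du) opprB addrA subrK.
rewrite ltW// (le_lt_trans (cabsD _ _))// cabsN.
by rewrite [e]splitr ltrD.
Qed.

(** Touching the unit circle only at 1, where the cut begins, this disc contains the unit disc and
    stays in the slit plane. *)
Definition discN1 : set K := [set z | cabs (z + 1) < 2].

Lemma open_discN1 : open discN1.
Proof.
rewrite openE => z zU; rewrite /interior; apply/nbhsCP.
exists (2 - cabs (z + 1)); first by rewrite subr_gt0.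
move=> w zw; rewrite /discN1/=.
have -> : w + 1 = (z + 1) - (z - w) by ring.
by rewrite (le_lt_trans (cabsD _ _))// cabsN -ltrBrDl.
Qed.

(** A union of segments that all start from the centre -1. *)
Lemma connected_discN1 : connected discN1.
Proof.
pose f z (t : R) : K := toC t * (z + 1) - 1.
have fE : discN1 = \bigcup_(z in discN1) (f z @` `[0%R, 1%R]).
  apply/seteqP; split=> [z zU|w [z zU [t]]].
    exists z => //; exists 1; first by rewrite /= in_itv/= ler01 lexx.
    by rewrite /f toC1 mul1r addrK.
  rewrite /= in_itv/= => /andP[t0 t1] <-; rewrite /discN1 /f/= subrK cabsM cabs_toC.
  rewrite ger0_norm// (le_lt_trans _ zU)// ler_piMl ?cabs_ge0//.
rewrite fE; apply: bigcup_connected.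
  exists (-1) => z zU; exists 0; first by rewrite /= in_itv/= ler01 lexx.
  by rewrite /f toC0 mul0r sub0r.
move=> z zU; apply: connected_continuous_connected; first exact: segment_connected.
apply: continuous_subspaceT => t; apply/cvgCP => e e0.
have M0 : 0 < cabs (z + 1) + 1 by rewrite ltr_wpDl ?cabs_ge0.
have eM0 : 0 < e / (cabs (z + 1) + 1) by rewrite divr_gt0.
near=> t'.
have -> : f z t - f z t' = toC (t - t') * (z + 1).
  by rewrite /f toCB; ring.
rewrite cabsM cabs_toC.
have : `|t - t'| < e / (cabs (z + 1) + 1).
  by near: t'; apply/nbhs_ballP; exists (e / (cabs (z + 1) + 1)).
rewrite ltr_pdivlMr// mulrDr mulr1; have := normr_ge0 (t - t'); lra.
Unshelve. all: by end_near. Qed.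

Lemma hyp2F1_value_uniq (p q r z w1 w2 : K) : cabs z = 1 ->
  hyp2F1_value p q r z w1 -> hyp2F1_value p q r z w2 -> w1 = w2.
Proof.
move=> z1 [U1 [g1 [[_ _ dU1 _ zU1] [h1 c1 ->]]]] [U2 [g2 [[_ _ dU2 _ zU2] [h2 c2 ->]]]].
apply: disc_cvg_eq => //; [exact: h1|exact: h2|].
by move=> u du; rewrite -(cvg_lim _ (c1 u du))// -(cvg_lim _ (c2 u du)).
Qed.

(** The range N is the same for all k, so that the double sums in [hyp2F1N1] can be exchanged. *)
Lemma exprD1n (A : comPzRingType) (u : A) k N : (k < N)%N ->
  (u + 1) ^+ k = \sum_(j < N) 'C(k, j)%:R * u ^+ j.
Proof.
move=> kN; rewrite addrC exprDn.
rewrite (big_ord_widen N (fun j => 1 ^+ (k - j) * u ^+ j *+ 'C(k, j)))// big_mkcond.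
apply: eq_bigr => j _; rewrite expr1n mul1r mulr_natl.
by case: ltnP => // kj; rewrite bin_small// mulr0n.
Qed.

(* The continuation is the expansion at -1, whose disc of radius 2 contains the
   unit disc.  On the latter, the partial sums of the two expansions at u differ by
   at most the difference of those at |u| (for the expansions at 0 and, evaluated
   at 1 + |u|, at -1), as all coefficients are positive. *)
Lemma hyp2F1N1 p q s : 0 < p -> 0 < q -> 0 < s ->
  hyp2F1 (toC p) (toC q) (toC (q + s)) (-1) = toC (euler p q s (-1)).
Proof.
move=> p0 q0 s0.
pose a n : K := toC (gauss_coef p q s n).
pose b n : K := toC (gauss_coefN1 p q s n).
have a0 n : 0 <= gauss_coef p q s n by exact: gauss_coef_ge0.
have b0 n : 0 <= gauss_coefN1 p q s n by exact: gauss_coefN1_ge0.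
have hb r : 0 <= r -> r < 2 -> cvgn (series (fun n => cabs (b n) * r ^+ n)).
  (* Chosen so that r <= 1 + x with 0 <= x < 1, the range where [gauss_seriesN1_cvg] gives
     convergence. *)
  move=> r0 r2; pose x := Num.max 0 (r - 1).
  have x01 : 0 <= x < 1 by rewrite le_max lexx/= gt_max ltr01/=; lra.
  have rx : r <= 1 + x by rewrite -lerBlDl le_max lexx orbT.
  have cx : cvgn (series (fun n => gauss_coefN1 p q s n * (1 + x) ^+ n)).
    by apply/cvg_ex; eexists; exact: gauss_seriesN1_cvg.
  apply: (series_le_cvg _ _ _ cx) => n.
  - by rewrite mulr_ge0 ?cabs_ge0 ?exprn_ge0.
  - by rewrite mulr_ge0 ?exprn_ge0// (le_trans r0).
  rewrite cabs_toC ger0_norm// ler_wpM2l// lerXn2r ?nnegrE//.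
  exact: le_trans rx.
pose g (z : K) := pseriesC b (z + 1).
have gN1 : g (-1) = toC (euler p q s (-1)).
  rewrite /g addNr /pseriesC.
  (* At the centre only the constant term remains, and it is Euler's integral at -1. *)
  have -> : toC (euler p q s (-1)) = b 0%N.
    rewrite /b /gauss_coefN1 /euler poch0 fact0 divr1 mul1r; congr (toC (fine _ / _)).
    by apply: eq_betaI => t _; rewrite expr0 mul1r addr0 mulN1r opprK.
  by apply/cvg_lim; [|exact: series_expr0].
have Vg : hyp2F1_value (toC p) (toC q) (toC (q + s)) (-1) (g (-1)).
  exists discN1, g; split.
    split.
    - exact: open_discN1.
    - exact: connected_discN1.
    - move=> z; rewrite discE => z1.
      rewrite /discN1/= (le_lt_trans (cabsD _ _))//.
      by rewrite (_ : cabs 1 = 1) ?ltrD2r// -toC1 cabs_toC normr1.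
    - move=> z zU; apply/negP => z1.
      have [x x0 zx] : exists2 x, 1 <= x & z = toC x.
        case: z z1 {zU} => u v; rewrite lecE/= => /andP[/eqP v0 u1].
        by exists u => //; rewrite v0.
      move: zU; rewrite /discN1/= zx -toC1 -toCD cabs_toC ger0_norm; lra.
    - by rewrite /discN1 /mkset addNr cabs0.
  split=> //.
  - move=> z zU; have [dz _ [dg _]] := pseriesC_derive hb zU.
    exact: derivable_shift dg.
  move=> u; rewrite discE => u1.
  have cb : series (fun k => b k * (u + 1) ^+ k) @ \oo --> g u.
    apply: (pseriesC_cvg hb); rewrite (le_lt_trans (cabsD _ _))//.
    by rewrite (_ : cabs 1 = 1) ?ltrD2r// -toC1 cabs_toC normr1.
  have E : series (hyp_term [:: toC p; toC q] [:: toC (q + s)] u) =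
      series (fun n => a n * u ^+ n).
    by apply/funext => N; apply: eq_bigr => n _; rewrite hyp_term_gauss.
  rewrite E; pose x := cabs u.
  have x01 : 0 <= x < 1 by rewrite cabs_ge0.
  have ca := gauss_series_cvg p0 q0 s0 x01.
  have cN := gauss_seriesN1_cvg p0 q0 s0 x01.
  have diff N : cabs (series (fun n => a n * u ^+ n) N -
        series (fun k => b k * (u + 1) ^+ k) N) <=
      series (fun n => gauss_coef p q s n * x ^+ n) N -
      series (fun k => gauss_coefN1 p q s k * (1 + x) ^+ k) N.
    (* The coefficient of x^j in the truncated expansion at -1; by [sum_coefN1_bin] it is at most
       [gauss_coef p q s j], so the bound at u follows term by term from the one at |u|. *)
    pose c j := \sum_(k < N) gauss_coefN1 p q s k * 'C(k, j)%:R.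
    have -> : series (fun k => b k * (u + 1) ^+ k) N = \sum_(j < N) toC (c j) * u ^+ j.
      rewrite /series/= big_mkord.
      transitivity (\sum_(k < N) \sum_(j < N) b k * ('C(k, j)%:R * u ^+ j)).
        apply: eq_bigr => k _; rewrite -mulr_sumr; congr (_ * _); exact: exprD1n.
      rewrite exchange_big/=; apply: eq_bigr => j _.
      rewrite toC_sum mulr_suml; apply: eq_bigr => k _.
      by rewrite toCM toC_nat mulrA.
    have -> : series (fun k => gauss_coefN1 p q s k * (1 + x) ^+ k) N =
        \sum_(j < N) c j * x ^+ j.
      rewrite /series/= big_mkord.
      transitivity (\sum_(k < N) \sum_(j < N)
          gauss_coefN1 p q s k * ('C(k, j)%:R * x ^+ j)).
        apply: eq_bigr => k _; rewrite -mulr_sumr addrC; congr (_ * _).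
        exact: exprD1n.
      rewrite exchange_big/=; apply: eq_bigr => j _.
      rewrite mulr_suml; apply: eq_bigr => k _.
      by rewrite mulrA.
    rewrite /series/= !big_mkord -!sumrB (le_trans (cabs_sum _ _ _))//.
    apply: ler_sum => j _; rewrite -!mulrBl cabsM cabsX -/x.
    rewrite ler_wpM2r ?exprn_ge0 ?cabs_ge0// -toCB cabs_toC ger0_norm//.
    by rewrite subr_ge0 sum_coefN1_bin.
  (* At the real point x both expansions converge to the same Euler integral. *)
  have cd : (fun N => series (fun n => gauss_coef p q s n * x ^+ n) N -
      series (fun k => gauss_coefN1 p q s k * (1 + x) ^+ k) N) @ \oo --> (0 : R).
    by rewrite -(subrr (euler p q s x)); exact: cvgB ca cN.
  apply/cvgCP => e e0; have e20 : 0 < e / 2 by rewrite divr_gt0.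
  move/cvgCP: cb => /(_ _ e20) cb; move/cvgrPdist_lt: cd => /(_ _ e20) cd.
  near=> N.
  have h1 : cabs (g u - series (fun k => b k * (u + 1) ^+ k) N) < e / 2.
    by near: N.
  have h2 : cabs (series (fun n => a n * u ^+ n) N -
      series (fun k => b k * (u + 1) ^+ k) N) < e / 2.
    apply: le_lt_trans (diff N) _; apply: le_lt_trans (ler_norm _) _.
    rewrite -normrN -[X in `|X|]sub0r; near: N; exact: cd.
  rewrite (_ : g u - _ = (g u - series (fun k => b k * (u + 1) ^+ k) N) -
    (series (fun n => a n * u ^+ n) N - series (fun k => b k * (u + 1) ^+ k) N)).
    by rewrite (le_lt_trans (cabsD _ _))// cabsN [e]splitr ltrD.
  by rewrite opprB addrA subrK.
rewrite -gN1; apply: xget_unique => // w Vw.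
by apply: hyp2F1_value_uniq Vw Vg; rewrite cabsN -toC1 cabs_toC normr1.
Unshelve. all: by end_near. Qed.

End gauss_function_at_N1.

(** * A coefficient criterion for parabolic starlikeness *)

(** Since Re w >= 1 - |1 - w|, the disc |w - 1| < 1/2 lies in the parabolic region. *)
Lemma norm_sub1_lt_Re (F : numClosedFieldType) (w : F) :
  `|w - 1| < 1 - `|w - 1| -> `|w - 1| < 'Re w.
Proof.
move=> h; apply: lt_le_trans h _.
have := (leif_Re_Creal (1 - w)).1.
rewrite raddfB/= (Creal_ReP _ (@real1 F)) distrC => h.
by rewrite lerBlDr addrC -lerBlDr.
Qed.

Section parabolic_starlike_criterion.
Context (R : realType).
Local Notation K := (Defs.C R).
Implicit Types (z w : K) (r : R).

Lemma cvg_succ (T : ptopologicalType) (u : nat -> T) (l : T) :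
  u @ \oo --> l -> (fun n => u n.+1) @ \oo --> l.
Proof. by move=> ul; rewrite (cvg_shiftS u). Qed.

Lemma series_recl (V : zmodType) (u : nat -> V) N :
  series u N.+1 = u 0%N + \sum_(0 <= n < N) u n.+1.
Proof. by rewrite /series/= big_nat_recl. Qed.

(** Keeping r^n, rather than bounding it by 1, is what leaves a factor r < 1 in
    [injective_mulid]. *)
Lemma cabs_subX z w r n : cabs z <= r -> cabs w <= r ->
  cabs (z ^+ n.+1 - w ^+ n.+1) <= cabs (z - w) * (n.+1%:R * r ^+ n).
Proof.
move=> zr wr; have r0 : 0 <= r by exact: le_trans (cabs_ge0 z) zr.
elim: n => [|n IH]; first by rewrite !expr1 expr0 !mulr1.
have -> : z ^+ n.+2 - w ^+ n.+2 =
    z * (z ^+ n.+1 - w ^+ n.+1) + w ^+ n.+1 * (z - w).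
  by rewrite (exprS z n.+1) (exprS w n.+1) mulrBr mulrBr (mulrC w) (mulrC _ z) addrA
    (mulrC z) subrK.
rewrite (le_trans (cabsD _ _))// !cabsM cabsX.
have h1 : cabs z * cabs (z ^+ n.+1 - w ^+ n.+1) <=
    r * (cabs (z - w) * (n.+1%:R * r ^+ n)) by rewrite ler_pM ?cabs_ge0.
have h2 : cabs w ^+ n.+1 * cabs (z - w) <= r ^+ n.+1 * cabs (z - w).
  by rewrite ler_wpM2r ?cabs_ge0// lerXn2r ?nnegrE ?cabs_ge0.
rewrite (le_trans (lerD h1 h2))// le_eqVlt; apply/orP; left; apply/eqP.
by rewrite -[in RHS]natr1 (exprS r); ring.
Qed.

Section criterion.
(** Here [k] lists the Taylor coefficients of f(z)/z and [t] majorizes them. B1 and B2 sum t_n over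
    n >= 1 and n t_n; they are separate because B1 controls f(z)/z - 1 and B2 its derivative. *)
Context (k : nat -> K) (t : nat -> R) (B1 B2 : R).
Hypotheses (k0 : k 0%N = 1) (kt : forall n, cabs (k n) <= t n).
Hypotheses (cB1 : series (fun n => if n == 0%N then 0 else t n) @ \oo --> B1)
  (cB2 : series (fun n => n%:R * t n) @ \oo --> B2) (B12 : B1 + 2 * B2 <= 1).

Let t0 n : 0 <= t n. Proof. exact: le_trans (cabs_ge0 _) (kt n). Qed.

Lemma coef_radius r : 0 <= r -> r < 1 -> cvgn (series (fun n => cabs (k n) * r ^+ n)).
Proof.
move=> r0 r1.
have c1 : cvgn (series (fun n => (if n == 0%N then 0 else t n) + (n == 0%N)%:R * t 0%N)).
  apply/cvg_ex; exists (B1 + t 0%N).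
  rewrite (_ : series _ = (fun N => series (fun n => if n == 0%N then 0 else t n) N +
    series (fun n => (n == 0%N)%:R * t 0%N) N)).
    apply: cvgD => //; rewrite -cvg_shiftS.
    rewrite (_ : [sequence _]_n = cst (t 0%N)); first exact: cvg_cst.
    apply/funext => n; rewrite /series/= big_nat_recl//= mul1r.
    by rewrite big1 ?addr0// => i _; rewrite mul0r.
  by apply/funext => N; rewrite /series/= big_split.
apply: (series_le_cvg _ _ _ c1) => n.
- by rewrite mulr_ge0 ?cabs_ge0 ?exprn_ge0.
- by case: n => [|n] /=; rewrite ?add0r ?mul1r ?mul0r ?addr0.
have -> : (if n == 0%N then 0 else t n) + (n == 0%N)%:R * t 0%N = t n.
  by case: n => [|n] /=; rewrite ?add0r ?mul1r ?mul0r ?addr0.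
by rewrite -[t n]mulr1 ler_pM ?cabs_ge0 ?exprn_ge0 ?exprn_ile1// ltW.
Qed.

Lemma series_scaled (u : nat -> R) r l : series u @ \oo --> l ->
  series (fun n => r * u n) @ \oo --> r * l.
Proof.
move=> ul; rewrite (_ : series _ = (fun N => r * series u N)).
  exact: (cvgM (cvg_cst r) ul).
by apply/funext => N; rewrite /series/= mulr_sumr.
Qed.

Lemma exprn_le_base r n : 0 <= r -> r < 1 -> (0 < n)%N -> r ^+ n <= r.
Proof.
by case: n => // n r0 r1 _; rewrite exprS ler_piMr// exprn_ile1// ltW.
Qed.

(** Every exponent is at least 1, so a factor |z| comes out. It makes the later inequalities strict
    even when B1 + 2 B2 = 1. *)
Lemma pseries_sub1 z : cabs z < 1 -> cabs (pseriesC k z - 1) <= cabs z * B1.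
Proof.
move=> z1.
have c : series (fun n => if n == 0%N then 0 else k n * z ^+ n) @ \oo -->
    pseriesC k z - 1.
  rewrite -cvg_shiftS.
  rewrite (_ : [sequence _]_n = (fun N => series (fun n => k n * z ^+ n) N.+1 - 1)).
    exact: (cvgB (cvg_succ (pseriesC_cvg coef_radius z1)) (cvg_cst (1 : K))).
  apply/funext => N; rewrite -[LHS]/(series _ N.+1) !series_recl eqxx k0 expr0 mulr1.
  by rewrite addrAC subrr.
apply: (cabs_series_le _ c (series_scaled (r := cabs z) cB1)) => n.
case: eqP => [_|/eqP n0]; first by rewrite mulr0 cabs0.
rewrite cabsM cabsX mulrC ler_pM ?exprn_ge0 ?cabs_ge0//.
by rewrite exprn_le_base ?cabs_ge0// lt0n.
Qed.

Lemma pseries_derive_bound z dz : cabs z < 1 ->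
  series (fun n => k n * (n%:R * z ^+ n.-1)) @ \oo --> dz ->
  cabs (z * dz) <= cabs z * B2.
Proof.
move=> z1 cdz.
have c : series (fun n => z * (k n * (n%:R * z ^+ n.-1))) @ \oo --> z * dz.
  rewrite (_ : series _ = (fun N => z * series (fun n => k n * (n%:R * z ^+ n.-1)) N)).
    exact: (cvgM (cvg_cst z) cdz).
  by apply/funext => N; rewrite /series/= mulr_sumr.
apply: (cabs_series_le _ c (series_scaled (r := cabs z) cB2)) => n.
rewrite !cabsM cabs_nat cabsX ler_wpM2l ?cabs_ge0// mulrCA ler_wpM2l//.
by rewrite -[t n]mulr1 ler_pM ?cabs_ge0 ?exprn_ge0 ?exprn_ile1 ?cabs_ge0// ltW.
Qed.

Lemma B_bounds : [/\ 0 <= B1, 0 <= B2 & B1 + 2 * B2 <= 1].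
Proof.
split=> //.
  rewrite -(cvg_lim _ cB1)//; apply: limr_ge; first by apply/cvg_ex; exists B1.
  by apply: nearW => N; apply: sumr_ge0 => n _; case: ifP.
rewrite -(cvg_lim _ cB2)//; apply: limr_ge; first by apply/cvg_ex; exists B2.
by apply: nearW => N; apply: sumr_ge0 => n _; rewrite mulr_ge0.
Qed.

Lemma pseries_neq0 z : cabs z < 1 -> pseriesC k z != 0.
Proof.
move=> z1; apply/eqP => F0; have := pseries_sub1 z1.
rewrite F0 sub0r cabsN -toC1 cabs_toC normr1.
have [b1 b2 b12] := B_bounds; have : cabs z * B1 <= cabs z; last by lra.
by rewrite ler_piMr ?cabs_ge0//; lra.
Qed.

Lemma is_derive_mulid z dz : is_derive z 1 (pseriesC k) dz ->
  is_derive z 1 (fun w => w * pseriesC k w) (pseriesC k z + z * dz).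
Proof.
move=> h; have := is_deriveM (is_derive_id z (1 : K)) h.
move=> H; apply: (@is_derive_eq _ _ _ _ _ _ _ _ H).
by rewrite /GRing.scale/= mulr1 addrC.
Qed.

Lemma class_A_mulid : class_A (fun z => z * pseriesC k z).
Proof.
split.
  move=> z; rewrite discE => z1.
  have [dz _ hdz] := pseriesC_derive coef_radius z1.
  by have [] := is_derive_mulid hdz.
exists (fun n => k n.-1) => z; rewrite discE => z1.
pose v N := z + \sum_(2 <= n < N) k n.-1 * z ^+ n.
(* The coefficient of z^n in f is k_(n-1); the two leading indices missing from the sum are 0 and
   the explicit term z. *)
have vE N : v N.+2 = z * series (fun n => k n * z ^+ n) N.+1.
  elim: N => [|N IH].
    by rewrite /v big_geq// addr0 series_recl big_geq// addr0 k0 expr0 !mulr1.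
  have -> : v N.+3 = v N.+2 + k N.+1 * z ^+ N.+2 by rewrite /v big_nat_recr//= addrA.
  by rewrite IH [in RHS]seriesSr [in RHS]mulrDr (exprS z N.+1) (mulrCA z).
rewrite -[X in X @ _ --> _]/v -cvg_shiftS -cvg_shiftS.
rewrite (_ : [sequence _]_n = (fun N => z * series (fun n => k n * z ^+ n) N.+1)).
  exact: (cvgM (cvg_cst z) (cvg_succ (pseriesC_cvg coef_radius z1))).
by apply/funext => N; exact: vE.
Qed.

(** If f(z) = f(w), then z - w is minus the sum over n >= 1 of k_n (z^(n+1) - w^(n+1)), whence |z -
    w| <= |z - w| r (B1 + B2) with r = max(|z|, |w|) < 1. As B1 + B2 <= 1, z = w. *)
Lemma injective_mulid : {in disc R &, injective (fun z => z * pseriesC k z)}.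
Proof.
move=> z w; rewrite !inE !discE => z1 w1 fzw.
apply/eqP; rewrite -subr_eq0 -cabs_eq0; apply/eqP.
pose r := Num.max (cabs z) (cabs w).
have r1 : r < 1 by rewrite gt_max z1.
have zr : cabs z <= r by rewrite le_max lexx.
have wr : cabs w <= r by rewrite le_max lexx orbT.
have r0 : 0 <= r by exact: le_trans (cabs_ge0 z) zr.
have cf u : cabs u < 1 -> series (fun n => k n * u ^+ n.+1) @ \oo --> u * pseriesC k u.
  move=> u1.
  rewrite (_ : series _ = (fun N => u * series (fun n => k n * u ^+ n) N)).
    exact: (cvgM (cvg_cst u) (pseriesC_cvg coef_radius u1)).
  by apply/funext => N; rewrite /series/= mulr_sumr; apply: eq_bigr => n _; rewrite exprS mulrCA.
have c : series (fun n => if n == 0%N then 0 else k n * (z ^+ n.+1 - w ^+ n.+1)) @ \oo -->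
    z * pseriesC k z - w * pseriesC k w - (z - w).
  rewrite -cvg_shiftS.
  rewrite (_ : [sequence _]_n = (fun N => (series (fun n => k n * z ^+ n.+1) N.+1 -
     series (fun n => k n * w ^+ n.+1) N.+1) - (z - w))).
    exact: (cvgB (cvgB (cvg_succ (cf z z1)) (cvg_succ (cf w w1))) (cvg_cst (z - w))).
  apply/funext => N; rewrite -[LHS]/(series _ N.+1) !series_recl eqxx k0 !mul1r !expr1.
  transitivity (\sum_(0 <= n < N) k n.+1 * z ^+ n.+2 -
    \sum_(0 <= n < N) k n.+1 * w ^+ n.+2); last by ring.
  by rewrite add0r -sumrB; apply: eq_bigr => i _; rewrite mulrBr.
have cb : series (fun n => (cabs (z - w) * r) * ((if n == 0%N then 0 else t n) + n%:R * t n))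
    @ \oo --> (cabs (z - w) * r) * (B1 + B2).
  apply: series_scaled.
  rewrite (_ : series _ = (fun N => series (fun n => if n == 0%N then 0 else t n) N +
    series (fun n => n%:R * t n) N)); first exact: cvgD.
  by apply/funext => N; rewrite /series/= big_split.
have := cabs_series_le _ c cb; rewrite fzw subrr sub0r cabsN => H.
have {}H : cabs (z - w) <= (cabs (z - w) * r) * (B1 + B2).
  apply: H => n; case: eqP => [->|/eqP n0]; first by rewrite cabs0 mul0r addr0 mulr0.
  rewrite cabsM (le_trans (ler_pM (cabs_ge0 _) (cabs_ge0 _) (kt n) (cabs_subX n zr wr)))//.
  have -> : t n + n%:R * t n = n.+1%:R * t n by rewrite -natr1; ring.
  rewrite [leLHS](_ : _ = cabs (z - w) * (n.+1%:R * t n) * r ^+ n); last by ring.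
  rewrite [leRHS](_ : _ = cabs (z - w) * (n.+1%:R * t n) * r); last by ring.
  by rewrite ler_wpM2l ?exprn_le_base ?lt0n// !mulr_ge0 ?cabs_ge0.
have [b1 b2 b12] := B_bounds; have := cabs_ge0 (z - w) => D0.
apply/eqP; rewrite eq_le D0 andbT.
have rB : r * (B1 + B2) <= r by rewrite ler_piMr//; lra.
rewrite leNgt; apply/negP => D1.
have := le_lt_trans H; rewrite -mulrA => /(_ (cabs (z - w))).
rewrite ltxx => /implyP; rewrite implybF -leNgt.
by rewrite ler_pMr// leNgt (le_lt_trans rB r1).
Qed.

(** Writing f(z) = z g(z), one has z f'/f - 1 = z g'/g. Now |z g'| <= |z| B2 and |g| >= 1 - |z| B1,
    so |z| (B1 + 2 B2) < 1 yields 2 |z g'| < |g|. *)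
Lemma class_Sp_mulid : class_Sp (fun z => z * pseriesC k z).
Proof.
split; first by split; [exact: class_A_mulid|exact: injective_mulid].
move=> z; rewrite discE => z1; apply: norm_sub1_lt_Re.
rewrite normCE -toC1 -toCB lt_toC.
suff : 2 * cabs (zdlog (fun z => z * pseriesC k z) z - 1) < 1 by lra.
rewrite /zdlog; case: eqP => [_|/eqP z0]; first by rewrite subrr cabs0 mulr0.
have F0 := pseries_neq0 z1.
have [dz cdz hdz] := pseriesC_derive coef_radius z1.
have [_ df] := is_derive_mulid hdz.
have fieldE (F : fieldType) (x y d : F) : x != 0 -> y != 0 ->
    x * (y + x * d) / (x * y) - 1 = x * d / y.
  by move=> x0 y0; field; apply/andP.
rewrite derive1E df fieldE// cabsM cabsV mulrA.
have Fp : 0 < cabs (pseriesC k z) by rewrite lt_neqAle eq_sym cabs_eq0 F0 cabs_ge0.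
rewrite ltr_pdivrMr// mul1r.
have h1 := pseries_sub1 z1; have h2 := pseries_derive_bound z1 cdz.
have h3 : 1 <= cabs (pseriesC k z) + cabs (pseriesC k z - 1).
  rewrite -(cabsN (_ - 1)); have := cabsD (pseriesC k z) (- (pseriesC k z - 1)).
  by rewrite opprB addrC subrK -toC1 cabs_toC normr1.
have [b1 b2 b12] := B_bounds; have z0' := cabs_ge0 z.
have h4 : cabs z * (B1 + 2 * B2) <= cabs z by rewrite ler_piMr.
lra.
Qed.

End criterion.

End parabolic_starlike_criterion.

(** * The hypergeometric coefficients *)

(** Lets the sums S1 and S2, complex in the hypothesis, be replaced by real ones. *)
Lemma series_toC (R : realType) (u : nat -> R) (S : Defs.C R) :
  series (fun n => toC (u n)) @ \oo --> S ->
  exists2 s, S = toC s & series u @ \oo --> s.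
Proof.
have ReB x : complex.Re (S - toC x) = complex.Re S - x by case: S.
move=> /cvgCP uS.
have E N : series (fun n => toC (u n)) N = toC (series u N).
  by rewrite /series/= toC_sum.
have us : series u @ \oo --> complex.Re S.
  apply/cvgrPdist_lt => e e0; near=> N.
  have : cabs (S - series (fun n => toC (u n)) N) < e by near: N; exact: uS.
  rewrite E; apply: le_lt_trans.
  by rewrite -ReB; exact: (ReIm_cabs _).1.
exists (complex.Re S) => //.
apply: (@cvg_unique _ _ (series (fun n => toC (u n)) @ \oo)) => //.
  by apply/cvgCP.
rewrite (_ : series _ = (fun N => toC (series u N))); last exact/funext.
exact: cvg_toC.
Unshelve. all: by end_near. Qed.

Section quadruplication.
Context (F : numFieldType).
Implicit Types x : F.

(** The 4n factors of (x)_(4n) are sorted by residue of their index modulo 4, and 4 is taken out of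
    each. *)
Lemma poch_quad x n :
  poch (x / 4) n * (poch ((x + 1) / 4) n * (poch ((x + 2) / 4) n *
    poch ((x + 3) / 4) n)) = poch x (4 * n) / (4 ^+ 4) ^+ n.
Proof.
elim: n => [|n IH]; first by rewrite muln0 !poch0 expr0 !mulr1 divr1.
have -> : (4 * n.+1 = (4 * n).+4)%N by rewrite mulnS addnC !addnS addn0.
rewrite !pochSr [RHS](_ : _ = (poch x (4 * n) / (4 ^+ 4) ^+ n) * ((x + (4 * n)%:R) *
  (x + (4 * n).+1%:R) * (x + (4 * n).+2%:R) * (x + (4 * n).+3%:R) / 4 ^+ 4)); last first.
  by rewrite exprS invfM; ring.
by rewrite -IH -!natr1 natrM; field.
Qed.

Lemma quad_cancel (a y u v : F) n :
  a * (y / (4 ^+ 4) ^+ n) / (u / (4 ^+ 4) ^+ n * v) = a * y / (u * v).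
Proof.
have d0 : (4 ^+ 4) ^+ n != 0 :> F by rewrite !expf_neq0// pnatr_eq0.
rewrite !invfM invrK.
transitivity (a * y * (u^-1 * v^-1) * (((4 ^+ 4) ^+ n)^-1 * (4 ^+ 4) ^+ n)); first by ring.
by rewrite mulVf// mulr1.
Qed.

End quadruplication.

Section coefficients.
Context (R : realType).
Local Notation K := (Defs.C R).

Definition quad_coef (a b c : K) n : K :=
  poch a n * poch b (4 * n) / (poch c (4 * n) * n`!%:R).

Definition quad_coefR (A B c : R) n : R :=
  poch A n * poch B (4 * n) / (poch c (4 * n) * n`!%:R).

Lemma hyp_quadE (a b c z : K) :
  hyp [:: a; b / 4; (b + 1) / 4; (b + 2) / 4; (b + 3) / 4]
      [:: c / 4; (c + 1) / 4; (c + 2) / 4; (c + 3) / 4] z =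
  pseriesC (quad_coef a b c) z.
Proof.
congr (limn (series _)); apply/funext => n.
rewrite /hyp_term !big_cons !big_nil !mulr1 !poch_quad poch1 /quad_coef.
congr (_ * _).
exact: quad_cancel.
Qed.

Lemma cabs_poch (a : K) n : cabs (poch a n) <= poch (cabs a) n.
Proof.
elim: n => [|n IH]; first by rewrite !poch0 -toC1 cabs_toC normr1.
rewrite !pochSr cabsM ler_pM ?cabs_ge0// (le_trans (cabsD _ _))//.
by rewrite cabs_nat.
Qed.

Lemma cabs_quad_coef (a b : K) (c : R) n : 0 < c ->
  cabs (quad_coef a b (toC c) n) <= quad_coefR (cabs a) (cabs b) c n.
Proof.
move=> c0; rewrite /quad_coef /quad_coefR poch_toC -toC_nat -toCM -toCV.
have h := poch_gt0 (4 * n) c0.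
rewrite !cabsM cabs_toC ger0_norm; last by rewrite invr_ge0 mulr_ge0 ?ltW.
by rewrite ler_pM ?mulr_ge0 ?cabs_ge0 ?invr_ge0 ?ler_pM ?cabs_poch ?cabs_ge0 ?mulr_ge0 ?(ltW h).
Qed.

Lemma quad_coefR_beta (A B c : R) n : 0 < B -> B < c ->
  quad_coefR A B c n =
  poch A n / n`!%:R * beta (B + (4 * n)%:R) (c - B) / beta B (c - B).
Proof.
move=> B0 Bc; have cB : 0 < c - B by rewrite subr_gt0.
rewrite beta_pochl// (addrC B (c - B)) subrK /quad_coefR.
have := beta_gt0 B0 cB => /gt_eqF/negbT ?.
have := poch_gt0 (4 * n) (lt_trans B0 Bc) => /gt_eqF/negbT ?.
by field; apply/and3P; split=> //; exact: factr_neq0.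
Qed.

(** Where the parameters |a| + 1 and |b| + 4 come from: (A)_(n+1) = A (A + 1)_n, the factor n + 1
    cancels in (n + 1)!, and 4 (n + 1) = 4 + 4n is absorbed by B. *)
Lemma quad_coefRS_beta (A B c : R) n : 0 < B -> B < c ->
  n.+1%:R * quad_coefR A B c n.+1 =
  A / beta B (c - B) * (poch (A + 1) n / n`!%:R * beta (B + 4 + (4 * n)%:R) (c - B)).
Proof.
move=> B0 Bc; have cB : 0 < c - B by rewrite subr_gt0.
rewrite quad_coefR_beta// pochS factS natrM.
rewrite (_ : B + (4 * n.+1)%:R = B + 4 + (4 * n)%:R); last by rewrite mulnS natrD; ring.
have := beta_gt0 B0 cB => /gt_eqF/negbT ?.
have := @factr_neq0 R n => ?; have n1 : n.+1%:R != 0 :> R by rewrite pnatr_eq0.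
move: (poch _ _) (beta (_ + _ + _) _) => X Y; field.
by apply/and3P.
Qed.

End coefficients.

Theorem theorem3p30 (R : realType) (a b : C R) (c : R) (S1 S2 : C R)
  (A := cabs a) (B := cabs b) :
  a != 0 -> b != 0 -> 0 < c -> A + B + 1 < c ->
  series (fun n : nat =>
      toC (binomN (A + 1) n *
           (Gamma (B + 4 + 2 * n%:R) / Gamma (c - A + 3 + 2 * n%:R))) *
      hyp2F1 (toC (A + 1)) (toC (B + 4 + 2 * n%:R))
             (toC (c - A + 3 + 2 * n%:R)) (-1))
    @ \oo --> S1 ->
  series (fun n : nat =>
      toC (binomN A n * (Gamma (B + 2 * n%:R) / Gamma (c - A + 2 * n%:R))) *
      hyp2F1 (toC A) (toC (B + 2 * n%:R)) (toC (c - A + 2 * n%:R)) (-1))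
    @ \oo --> S2 ->
  toC (Gamma c * Gamma (c - A - B) / (Gamma B * Gamma (c - B))) *
    (toC (2 * A / (c - A - B - 1)) * S1 + S2) <= 2 ->
  class_Sp (fun z : C R =>
    z * hyp [:: a; b / 4; (b + 1) / 4; (b + 2) / 4; (b + 3) / 4]
            [:: toC c / 4; (toC c + 1) / 4; (toC c + 2) / 4; (toC c + 3) / 4]
            z).
Proof.
move=> a0 b0 c0 ABc cS1 cS2 le2.
have A0 : 0 < A by rewrite lt_neqAle eq_sym cabs_eq0 a0 cabs_ge0.
have B0 : 0 < B by rewrite lt_neqAle eq_sym cabs_eq0 b0 cabs_ge0.
(* The second beta parameter for the series S1; the one for S2 is larger by 1. *)
have y0 : 0 < c - A - B - 1 by lra.
have y0' : 0 < c - A - B by lra.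
have Bc : B < c by lra.
have A1 : 0 < A + 1 by lra.
have B4 : 0 < B + 4 by lra.
have [s1 S1E cs1] : exists2 s1, S1 = toC s1 & series (fun n =>
    poch (A + 1) n / n`!%:R * beta (B + 4 + (4 * n)%:R) (c - B)) @ \oo -->
      Gamma (c - A - B - 1) * s1.
  pose u n : R := binomN (A + 1) n *
    (Gamma (B + 4 + 2 * n%:R) / Gamma (c - A - B - 1 + (B + 4 + 2 * n%:R))) *
    euler (A + 1) (B + 4 + 2 * n%:R) (c - A - B - 1) (-1).
  move: cS1; set F := (X in series X) => cS1.
  have E : (fun n => toC (u n)) = F.
    apply/funext => n; have Bn : 0 < B + 4 + 2 * n%:R by rewrite ltr_wpDr ?mulr_ge0.
    (* Splits the lower parameter as q + s for Euler's integral. Here s = c - A - B - 1, and s + (A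
       + 1) = c - B is the same beta parameter as for S2. *)
    have EFc : c - A + 3 + 2 * n%:R = B + 4 + 2 * n%:R + (c - A - B - 1) by ring.
    by rewrite /F EFc hyp2F1N1// -toCM /u (addrC (c - A - B - 1)).
  rewrite -E in cS1; have [s1 S1E cu] := series_toC cS1.
  exists s1; first exact: S1E.
  have := binomial_beta_series A1 B4 y0 cu.
  by rewrite (_ : c - A - B - 1 + (A + 1) = c - B); last by ring.
have [s2 S2E cs2] : exists2 s2, S2 = toC s2 & series (fun n =>
    poch A n / n`!%:R * beta (B + (4 * n)%:R) (c - B)) @ \oo -->
      Gamma (c - A - B) * s2.
  pose u n : R := binomN A n *
    (Gamma (B + 2 * n%:R) / Gamma (c - A - B + (B + 2 * n%:R))) *
    euler A (B + 2 * n%:R) (c - A - B) (-1).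
  move: cS2; set F := (X in series X) => cS2.
  have E : (fun n => toC (u n)) = F.
    apply/funext => n; have Bn : 0 < B + 2 * n%:R by rewrite ltr_wpDr ?mulr_ge0.
    have EFc : c - A + 2 * n%:R = B + 2 * n%:R + (c - A - B) by ring.
    by rewrite /F EFc hyp2F1N1// -toCM /u (addrC (c - A - B)).
  rewrite -E in cS2; have [s2 S2E cu] := series_toC cS2.
  exists s2; first exact: S2E.
  have := binomial_beta_series A0 B0 y0' cu.
  by rewrite (_ : c - A - B + A = c - B); last by ring.
pose t n : R := quad_coefR A B c n.
have cB : 0 < c - B by rewrite subr_gt0.
have bt0 := beta_gt0 B0 cB.
have t0E : t 0%N = 1.
  by rewrite /t /quad_coefR muln0 !poch0 fact0 !mulr1 divr1.
have ct : series t @ \oo --> Gamma (c - A - B) * s2 / beta B (c - B).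
  rewrite (_ : series t = (fun N => series (fun n =>
    poch A n / n`!%:R * beta (B + (4 * n)%:R) (c - B)) N / beta B (c - B))).
    exact: (cvgM cs2 (cvg_cst _)).
  apply/funext => N; rewrite /series/= mulr_suml; apply: eq_bigr => n _.
  exact: quad_coefR_beta.
(* Removing t_0 = 1 turns the bound 2 of the hypothesis into the bound 1 of the criterion. *)
have cB1 : series (fun n => if n == 0%N then 0 else t n) @ \oo -->
    Gamma (c - A - B) * s2 / beta B (c - B) - 1.
  rewrite -cvg_shiftS.
  rewrite (_ : [sequence _]_n = (fun N => series t N.+1 - 1)).
    exact: (cvgB (cvg_succ ct) (cvg_cst (1 : R))).
  apply/funext => N; rewrite -[LHS]/(series _ N.+1) !series_recl t0E/=.
  by rewrite addrAC subrr.
have cB2 : series (fun n => n%:R * t n) @ \oo -->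
    A / beta B (c - B) * (Gamma (c - A - B - 1) * s1).
  rewrite -cvg_shiftS.
  rewrite (_ : [sequence _]_n = (fun N => A / beta B (c - B) * series (fun n =>
    poch (A + 1) n / n`!%:R * beta (B + 4 + (4 * n)%:R) (c - B)) N)).
    exact: (cvgM (cvg_cst _) cs1).
  apply/funext => N; rewrite -[LHS]/(series _ N.+1) series_recl mul0r add0r.
  by rewrite /series/= mulr_sumr; apply: eq_bigr => n _; exact: quad_coefRS_beta.
under [X in class_Sp X]funext => z do rewrite hyp_quadE.
apply: (class_Sp_mulid (t := t) _ _ cB1 cB2).
- by rewrite /quad_coef muln0 !poch0 fact0 !mulr1 divr1.
- by move=> n; exact: cabs_quad_coef.
move: le2; rewrite S1E S2E -toCM -toCD -toCM -(toC_nat R 2) le_toC.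
(* Both sums then share the factor Gamma(c - A - B - 1), and c - A - B - 1 matches the denominator
   in the coefficient of S1. *)
have -> : Gamma (c - A - B) = (c - A - B - 1) * Gamma (c - A - B - 1).
  by rewrite -(GammaS y0) subrK.
have fieldE (F : fieldType) (x y g p q r u v : F) :
    y != 0 -> p != 0 -> q != 0 -> r != 0 ->
    y * g * v / (p * q / r) - 1 + 2 * (x / (p * q / r) * (g * u)) =
    r * (y * g) / (p * q) * (2 * x / y * u + v) - 1.
  by move=> y1 p1 q1 r1; field; rewrite y1 p1 q1 r1.
rewrite /beta (addrC B) subrK fieldE ?lerBlDr//; apply: lt0r_neq0 => //.
- exact: Gamma_gt0.
- exact: Gamma_gt0.
- exact: Gamma_gt0.
Qed.
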